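(* Let $f_1,\dots,f_N:\mathbb{R}^N\to\mathbb{R}$ be the players' cost functions. Suppose that: (1) each $f_i$ is a $\mathcal{C}^2$ function; (2) the players are equipped with a communication graph $\mathcal{G}$ on the node set $\{1,\dots,N\}$ which is undirected and connected; (3) there exists a constant $m>0$ such that $(\mathbf{x}-\mathbf{z})^T(\bar{\mathcal{P}}(\mathbf{x})-\bar{\mathcal{P}}(\mathbf{z}))\ge m\|\mathbf{x}-\mathbf{z}\|^2$ for all $\mathbf{x},\mathbf{z}\in\mathbb{R}^N$, where $\bar{\mathcal{P}}(\mathbf{x})=[\nabla_1f_1(\mathbf{x}),\dots,\nabla_Nf_N(\mathbf{x})]^T$. Let $\bar U>0$ and let $K_i>0$ and $\bar\theta_{ij}>0$, $i,j\in\{1,\dots,N\}$, be fixed constants. For $\theta,\theta_1>0$ put $\bar K_i=\theta_1K_i$ and $\theta_{ij}=\theta\theta_1\bar\theta_{ij}$, and consider the system, for $i,j\in\{1,\dots,N\}$, $$\dot x_i=\nu_i,\qquad \dot\nu_i=-\rho_{\bar U}\big((x_i-z_i)+(\nu_i-\dot z_i)\big),\qquad \dot z_i=-\bar K_i\nabla_if_i(\mathbf{y}_i),$$ $$\dot y_{ij}=-\theta_{ij}\Big(\sum_{k=1}^Na_{ik}(y_{ij}-y_{kj})+a_{ij}(y_{ij}-z_j)\Big).$$ Then for any positive constant $\Delta$ there exists a positive constant $\theta^*$ such that for each $\theta\in(\theta^*,\infty)$ there exists a positive constant $\theta_1^*(\Delta,\theta)$ such that for each $\theta_1\in(0,\theta_1^*(\Delta,\theta))$,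 the component $\mathbf{x}$ generated by this system converges asymptotically to the Nash equilibrium $\mathbf{x}^*$ given that $$\Big\|\big[(\nu(0)-\dot{\mathbf{z}}(0))^T,\,(\mathbf{x}(0)-\mathbf{z}(0))^T,\,(\mathbf{y}(0)-\mathbf{1}_N\otimes\mathbf{z}(0))^T,\,(\mathbf{z}(0)-\mathbf{x}^* )^T\big]^T\Big\|\le\Delta.$$
   Context: There is a game with $N\ge 2$ players; player $i$ has action $x_i\in\mathbb{R}$ and cost function $f_i(\mathbf{x})$, $\mathbf{x}=[x_1,\dots,x_N]^T$. Also write $f_i(\mathbf{x})=f_i(x_i,\mathbf{x}_{-i})$ with $\mathbf{x}_{-i}=[x_1,\dots,x_{i-1},x_{i+1},\dots,x_N]^T$. Notation: $\nabla_if_i(\mathbf{x})=\frac{\partial f_i(\mathbf{x})}{\partial x_i}$; $\nu=[\nu_1,\dots,\nu_N]^T$; $z_i,y_{ij}\in\mathbb{R}$ are auxiliary variables, $\mathbf{z}=[z_1,\dots,z_N]^T$, $\mathbf{y}_i=[y_{i1},\dots,y_{iN}]^T\in\mathbb{R}^N$, $\mathbf{y}=[\mathbf{y}_1^T,\dots,\mathbf{y}_N^T]^T\in\mathbb{R}^{N^2}$; $\nabla_if_i(\mathbf{y}_i)=\frac{\partial f_i(\mathbf{x})}{\partial x_i}\big|_{\mathbf{x}=\mathbf{y}_i}$; $\mathbf{1}_N\in\mathbb{R}^N$ is the all-ones vector and $\otimes$ the Kronecker product. In the equation for $\dot\nu_i$, $\dot z_i$ stands for the expression $-\bar K_i\nabla_if_i(\mathbf{y}_i)$;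 likewise $\dot{\mathbf{z}}(0)$ is the vector with entries $-\bar K_i\nabla_if_i(\mathbf{y}_i(0))$. $a_{ij}$ is the $(i,j)$ entry of the adjacency matrix of $\mathcal{G}$ ($a_{ij}=a_{ji}=1$ if $\{i,j\}$ is an edge, $a_{ij}=0$ otherwise, $a_{ii}=0$). A Nash equilibrium is a point $\mathbf{x}^*=(x_i^*,\mathbf{x}_{-i}^* )\in\mathbb{R}^N$ such that $f_i(x_i^*,\mathbf{x}_{-i}^* )\le f_i(x_i,\mathbf{x}_{-i}^* )$ for all $x_i\in\mathbb{R}$ and all $i$. (Under hypothesis (3) it exists and is unique, and it is the unique zero of $\bar{\mathcal P}$.) The saturation function is $\rho_{\bar U}(\eta)=\mathrm{sgn}(\eta)\min\{|\eta|,\bar U\}$ for $\eta\in\mathbb{R}$. *)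

(* Defs.v *)
From mathcomp Require Import all_boot all_order all_algebra.
From mathcomp Require Import all_classical all_reals all_analysis.

Set Implicit Arguments.
Unset Strict Implicit.
Unset Printing Implicit Defensive.

Import Order.TTheory GRing.Theory Num.Theory.
Import numFieldNormedType.Exports.

Local Open Scope classical_set_scope.
Local Open Scope ring_scope.

(* Points of R^N are row vectors. The norm `|_| of MathComp-Analysis on
   matrices is the sup norm, hence the separate Euclidean norm [enorm]; the
   two induce the same topology. *)
Section Calculus.
Context {R : realType} {N : nat}.

Definition enorm (v : 'rV[R]_N) : R := Num.sqrt (\sum_i v 0 i ^+ 2).

Definition partial (i : 'I_N) (g : 'rV[R]_N -> R) (x : 'rV[R]_N) : R :=
  'D_(delta_mx 0 i) g x.

(* All iterated partial derivatives of order at most k exist everywhere and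
   are continuous. The derivability clause is needed because 'D_v is total. *)
Fixpoint Ck (k : nat) (g : 'rV[R]_N -> R) : Prop :=
  continuous g /\
  (if k is k'.+1 then
     forall i : 'I_N,
       (forall x, derivable g x (delta_mx 0 i)) /\ Ck k' (partial i g)
   else True).

End Calculus.

Section Game.
Context {R : realType} {N : nat}.
Implicit Types (f : 'I_N -> 'rV[R]_N -> R) (x : 'rV[R]_N).

Definition set_action x (i : 'I_N) (a : R) : 'rV[R]_N :=
  \row_j (if j == i then a else x 0 j).

Definition nash_equilibrium f x : Prop :=
  forall (i : 'I_N) (a : R), f i x <= f i (set_action x i a).

Definition pseudo_gradient f x : 'rV[R]_N := \row_i partial i (f i) x.

Definition strongly_monotone (m : R) (P : 'rV[R]_N -> 'rV[R]_N) : Prop :=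
  forall x z : 'rV[R]_N,
    m * enorm (x - z) ^+ 2 <= ((x - z) *m (P x - P z)^T) 0 0.

End Game.

Section Graph.
Context {N : nat}.

Definition undirected_graph (e : rel 'I_N) : Prop :=
  symmetric e /\ irreflexive e.

Definition connected_graph (e : rel 'I_N) : Prop :=
  forall i j : 'I_N, connect e i j.

Definition adjacency {R : realType} (e : rel 'I_N) (i j : 'I_N) : R :=
  (e i j)%:R.

End Graph.

Section Dynamics.
Context {R : realType} {N : nat}.
Implicit Types (f : 'I_N -> 'rV[R]_N -> R) (e : rel 'I_N).

Definition saturation (U eta : R) : R := Num.sg eta * Num.min `|eta| U.

(* The estimates y_ij are the entries of an N x N matrix, so that the vector
   y_i is [row i y]. *)
Definition zdot f (Kb : 'I_N -> R) (y : 'M[R]_N) : 'rV[R]_N :=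
  \row_i (- Kb i * partial i (f i) (row i y)).

Definition nudot f (U : R) (Kb : 'I_N -> R) (x nu z : 'rV[R]_N) (y : 'M[R]_N) :
    'rV[R]_N :=
  \row_i (- saturation U ((x 0 i - z 0 i) + (nu 0 i - zdot f Kb y 0 i))).

Definition ydot e (th : 'I_N -> 'I_N -> R) (z : 'rV[R]_N) (y : 'M[R]_N) :
    'M[R]_N :=
  \matrix_(i, j)
    (- th i j * (\sum_k adjacency e i k * (y i j - y k j)
                 + adjacency e i j * (y i j - z 0 j))).

(* Forward solutions on [0, +oo[: continuous on [0, +oo[ and satisfying the
   equations on ]0, +oo[; as the right-hand sides are continuous for C^1
   pseudo-gradients, the one-sided equations at 0 then follow. Nothing is
   required of the values at negative times. *)
Record forward_solution f e (U : R) (Kb : 'I_N -> R) (th : 'I_N -> 'I_N -> R)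
    (x nu z : R -> 'rV[R]_N) (y : R -> 'M[R]_N) : Prop := ForwardSolution {
  sol_x_cont : {within `[0, +oo[, continuous x};
  sol_nu_cont : {within `[0, +oo[, continuous nu};
  sol_z_cont : {within `[0, +oo[, continuous z};
  sol_y_cont : {within `[0, +oo[, continuous y};
  sol_x : forall t : R, 0 < t -> is_derive t 1 x (nu t);
  sol_nu : forall t : R, 0 < t ->
    is_derive t 1 nu (nudot f U Kb (x t) (nu t) (z t) (y t));
  sol_z : forall t : R, 0 < t -> is_derive t 1 z (zdot f Kb (y t));
  sol_y : forall t : R, 0 < t -> is_derive t 1 y (ydot e th (z t) (y t))
}.

(* [mxvec] stacks the rows y_1, ..., y_N, and the matrix [const_mx 1 *m z],
   all of whose rows are z, is the corresponding shape of 1_N (x) z. *)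
Definition initial_error f (Kb : 'I_N -> R) (xstar x0 nu0 z0 : 'rV[R]_N)
    (y0 : 'M[R]_N) : R :=
  enorm (row_mx (nu0 - zdot f Kb y0)
        (row_mx (x0 - z0)
        (row_mx (mxvec (y0 - (const_mx 1 : 'cV[R]_N) *m z0))
                (z0 - xstar)))).

End Dynamics.

(* Main.v *)
Require Import Defs.
From mathcomp Require Import all_boot all_order all_algebra.
From mathcomp Require Import all_classical all_reals all_analysis.
From mathcomp Require Import ring lra.

Import Order.TTheory GRing.Theory Num.Theory.
Import numFieldNormedType.Exports.

Set Implicit Arguments.
Unset Strict Implicit.
Unset Printing Implicit Defensive.

Local Open Scope classical_set_scope.
Local Open Scope ring_scope.

(** The proof treats the cascade (z, y) -> (x, nu).

    The pair (z, y) evolves on its own: z descends along the pseudo-gradient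
    evaluated at the estimates y_i of z. A Lyapunov function is a weighted sum
    of the squares of a_i = z_i - x*_i and b_ij = y_ij - z_j. Strong
    monotonicity damps a. For each j the column b_.j is damped by theta times
    the Laplacian of the graph grounded at the neighbours of j, a form which is
    positive definite because the graph is connected
    ([grounded_form_coercive]). The cross terms are controlled by a Lipschitz
    constant of the gradients, and are beaten once theta is large
    ([dissipation_le]). The gradients are Lipschitz on bounded sets only
    ([Ck1_lipschitz_on_box]), so the constant is taken on a box whose size
    comes from Delta; this is why theta^* depends on Delta. Sublevel sets of
    the Lyapunov function inside that box are invariant
    ([sublevel_invariant]), and both errors, hence also the velocity of z,
    decay exponentially ([seeking_system_stable]).

    For player i put s = (x_i - x*_i) + nu_i. Then
    nu_i' = - sat (s + d) with d = - (z_i - x*_i) - z_i', and d is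
    exponentially small. As sat is 1-Lipschitz, d amounts to an additive
    integrable perturbation of the saturated double integrator x' = nu,
    nu' = - sat (x + nu), which is globally asymptotically stable and
    tolerates it ([saturated_double_integrator_cvg0]). The second derivative
    of z never appears.

    Solutions are obtained from the same estimates: composing the gradients
    with the projection onto the box makes the vector field globally
    Lipschitz, Picard iteration solves the modified system for all times
    ([picard_lindelof]), and the a priori bound shows that the estimates stay
    in the box, where the modification is invisible. *)

(** * Entrywise limits and derivatives *)

Section MatrixValued.
Context {R : realType}.

Lemma cvg_mx (T : Type) (F : set_system T) {FF : ProperFilter F} m n
    (M : T -> 'M[R]_(m, n)) (l : 'M[R]_(m, n)) :
  (forall i j, M t i j @[t --> F] --> l i j) -> M t @[t --> F] --> l.
Proof.
move=> Ml; apply/cvgrPdist_le => /= e e0; near=> t.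
rewrite /Num.Def.normr/= mx_normrE (bigmax_le _ (ltW e0))//= => i _.
rewrite !mxE; move: i; near: t; apply: filter_forall => /= i.
by have /cvgrPdist_le := Ml i.1 i.2; exact.
Unshelve. all: by end_near. Qed.

Lemma is_derive_mxP m n (M : R -> 'M[R]_(m, n)) (dM : 'M[R]_(m, n)) (t : R) :
  is_derive t 1 M dM <->
  forall i j, is_derive t 1 (fun s => M s i j) (dM i j).
Proof.
split=> [[dMt <-] i j|Md].
  rewrite derive_mx // mxE; apply: DeriveDef => //.
  by move/derivable_mxP: dMt; apply.
have dMt : derivable M t 1 by apply/derivable_mxP => i j; have [] := Md i j.
apply: DeriveDef => //; rewrite derive_mx //.
by apply/matrixP => i j; rewrite mxE; have [_ ->] := Md i j.
Qed.

End MatrixValued.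

(** * Derivatives of real functions *)

Section RealCalculus.
Context {R : realType}.
Implicit Types (f g h : R -> R) (a b t : R).

Lemma is_derive_fun_add f g t a b : is_derive t 1 f a -> is_derive t 1 g b ->
  is_derive t 1 (fun s => f s + g s) (a + b).
Proof. by move=> df dg; exact: is_deriveD. Qed.

Lemma is_derive_fun_opp f t a : is_derive t 1 f a ->
  is_derive t 1 (fun s => - f s) (- a).
Proof. by move=> df; exact: is_deriveN. Qed.

Lemma is_derive_fun_sub f g t a b : is_derive t 1 f a -> is_derive t 1 g b ->
  is_derive t 1 (fun s => f s - g s) (a - b).
Proof. by move=> df dg; exact: is_deriveB. Qed.

Lemma is_derive_fun_mul f g t a b : is_derive t 1 f a -> is_derive t 1 g b ->
  is_derive t 1 (fun s => f s * g s) (f t * b + g t * a).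
Proof. by move=> df dg; exact: is_deriveM. Qed.

Lemma is_derive_fun_scale f t a b : is_derive t 1 f a ->
  is_derive t 1 (fun s => b * f s) (b * a).
Proof.
move=> df; have := is_derive_fun_mul (is_derive_cst b t 1) df.
by move/is_derive_eq; apply; rewrite mulr0 addr0.
Qed.

Lemma is_derive_fun_sqr f t a : is_derive t 1 f a ->
  is_derive t 1 (fun s => f s ^+ 2) (2 * (f t * a)).
Proof.
move=> df; have := is_derive_fun_mul df df.
rewrite [_ + _](_ : _ = 2 * (f t * a)) //.
by ring.
Qed.

Lemma is_derive_fun_sum (I : finType) (F : I -> R -> R) (dF : I -> R) t :
  (forall i, is_derive t 1 (F i) (dF i)) ->
  is_derive t 1 (fun s => \sum_i F i s) (\sum_i dF i).
Proof.
move=> dFi; elim: (index_enum I) => [|i r ih].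
  rewrite big_nil (_ : (fun s => _) = cst 0); first exact: is_derive_cst.
  by apply/funext => s; rewrite big_nil.
rewrite big_cons (_ : (fun s => _) = fun s => F i s + \sum_(j <- r) F j s).
  exact: is_derive_fun_add.
by apply/funext => s; rewrite big_cons.
Qed.

Lemma continuous_fun_sum (I : finType) (F : I -> R -> R) :
  (forall i, continuous (F i)) -> continuous (fun s => \sum_i F i s).
Proof.
move=> cF t; elim: (index_enum I) => [|i r ih].
  rewrite (_ : (fun s => _) = cst 0); first exact: cvg_cst.
  by apply/funext => s; rewrite big_nil.
rewrite (_ : (fun s => _) = fun s => F i s + \sum_(j <- r) F j s).
  by apply: cvgD; [exact: cF|exact: ih].
by apply/funext => s; rewrite big_cons.
Qed.

Lemma is_derive_fun_comp f g t a b : is_derive t 1 f a -> is_derive (f t) 1 g b ->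
  is_derive t 1 (fun s => g (f s)) (b * a).
Proof. by move=> df dg; exact: is_derive1_comp dg df. Qed.

Lemma is_derive_exp_scale (c t : R) :
  is_derive t 1 (fun s => expR (c * s)) (c * expR (c * t)).
Proof.
have := is_derive_fun_comp (is_derive_fun_scale c (is_derive_id t 1))
  (is_derive_expR (c * t)).
by rewrite mulr1 mulrC.
Qed.

Lemma le_of_derive_le0 (h dh : R -> R) a b : a <= b ->
  {within `[a, b], continuous h} ->
  (forall t, a < t -> t < b -> is_derive t 1 h (dh t)) ->
  (forall t, a < t -> t < b -> dh t <= 0) -> h b <= h a.
Proof.
rewrite le_eqVlt => /predU1P[-> //|ab] hc hd hneg.
have [t|c /[!in_itv]/= /andP[ac cb] E] := @MVT _ h dh a b ab _ hc.
  by rewrite in_itv/= => /andP[]; exact: hd.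
rewrite -subr_le0 E mulr_le0_ge0 ?subr_ge0 ?(ltW ab) //; exact: hneg.
Qed.

(** Extending a function by its value at 0 on the negative half-line turns
    one-sided continuity on [0, +oo[ into continuity on the line. *)
Lemma continuous_of_within_ge0 (T : topologicalType) (h : R -> T) :
  {within `[0, +oo[, continuous h} -> continuous (fun t => h (Num.max 0 t)).
Proof.
move=> /subspace_continuousP hc t.
have max_in (s : R) : `[0, +oo[%classic (Num.max 0 s).
  by rewrite /= in_itv/= andbT le_max lexx.
move: (hc _ (max_in t)); apply: cvg_comp => A.
rewrite /within/= => /= hA.
have mc : {for t, continuous (fun s : R => Num.max 0 s)}.
  by apply: continuous_max; [exact: cvg_cst|exact: cvg_id].
suff : nbhs t [set s : R | A (Num.max 0 s)] by [].
have : nbhs t [set s : R | Num.max 0 s \in `[0, +oo[ -> A (Num.max 0 s)].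
  exact: mc _ hA.
by apply: filterS => s /=; apply; exact: max_in.
Qed.

Lemma near_max0 t : 0 < t -> \forall s \near t, Num.max 0 s = s.
Proof.
move=> t0; near=> s; apply/max_idPr/ltW; near: s.
exact: lt_nbhsr.
Unshelve. all: by end_near. Qed.

Lemma is_derive_max0 (h : R -> R) t a : 0 < t ->
  is_derive t 1 (fun s => h (Num.max 0 s)) a <-> is_derive t 1 h a.
Proof.
by move=> t0; split; apply: near_eq_is_derive;
  apply: filterS (near_max0 t0) => s ->.
Qed.

End RealCalculus.

(** * Primitives and comparison of functions on a half-line *)

Section Primitive.
Context {R : realType}.
Implicit Types (phi : R -> R) (t : R).

(** The lower bound -1 makes 0 an interior point of the domain of integration,
    where the integral is still differentiable, hence continuous. *)
Definition integral_from phi t : R :=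
  Rintegral (@lebesgue_measure R) `[-1, t] phi.

(** Frozen for negative times, so that continuity on the whole line comes with
    differentiability on the open half-line. *)
Definition primitive phi t : R :=
  integral_from phi (Num.max 0 t) - integral_from phi 0.

Lemma is_derive_integral_from phi t : continuous phi -> -1 < t ->
  is_derive t 1 (integral_from phi) (phi t).
Proof.
move=> cphi t1.
have tt1 : t < t + 1 by rewrite ltrDl.
have [|d1 d2] := @continuous_FTC1_closed R phi (-1) t (t + 1) tt1 _ t1 (cphi t).
  apply: continuous_compact_integrable; first exact: segment_compact.
  exact: continuous_subspaceT.
by apply: DeriveDef => //; rewrite -d2 derive1E.
Qed.

Lemma is_derive_continuous (h : R -> R) t a : is_derive t 1 h a ->
  {for t, continuous h}.
Proof. by case=> dh _; exact/differentiable_continuous/derivable1_diffP. Qed.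

Lemma continuous_primitive phi : continuous phi -> continuous (primitive phi).
Proof.
move=> cphi t.
suff c : {for t, continuous (fun s : R => integral_from phi (Num.max 0 s))}.
  exact: (continuousB c (@cst_continuous _ _ (integral_from phi 0) t)).
have mc : {for t, continuous (fun s : R => Num.max 0 s)}.
  by apply: continuous_max; [exact: cvg_cst|exact: cvg_id].
apply: (continuous_comp mc); apply: is_derive_continuous.
by apply: is_derive_integral_from => //; rewrite lt_max ltrN10.
Qed.

Lemma primitive0 phi : primitive phi 0 = 0.
Proof. by rewrite /primitive maxxx subrr. Qed.

Lemma is_derive_primitive phi t : continuous phi -> 0 < t ->
  is_derive t 1 (primitive phi) (phi t).
Proof.
move=> cphi t0.
suff d : is_derive t 1 (fun s => integral_from phi (Num.max 0 s)) (phi t).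
  have := is_derive_fun_sub d (is_derive_cst (integral_from phi 0) t 1).
  by rewrite subr0.
apply/is_derive_max0 => //; apply: is_derive_integral_from => //.
by rewrite (lt_trans _ t0)// ltrN10.
Qed.

End Primitive.

Section Comparison.
Context {R : realType}.

(** Integral estimates are replaced by this comparison: to bound a function it
    suffices to exhibit a bound with a larger derivative. *)
Lemma normr_le_of_derive (w dw h dh : R -> R) (t : R) :
  continuous w -> continuous h -> w 0 = 0 -> 0 <= h 0 ->
  (forall s : R, 0 < s -> is_derive s 1 w (dw s)) ->
  (forall s : R, 0 < s -> is_derive s 1 h (dh s)) ->
  (forall s : R, 0 < s -> `|dw s| <= dh s) -> 0 <= t -> `|w t| <= h t.
Proof.
move=> cw ch w0 h0 dw_ dh_ dwh t0.
have bound (sw : R -> R) (sdw : R -> R) : continuous sw -> sw 0 = 0 ->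
    (forall s : R, 0 < s -> is_derive s 1 sw (sdw s)) ->
    (forall s : R, 0 < s -> sdw s <= dh s) -> sw t <= h t.
  move=> csw sw0 dsw le; rewrite -subr_le0.
  apply: (@le_trans _ _ (sw 0 - h 0)); last by rewrite sw0 sub0r oppr_le0.
  apply: (@le_of_derive_le0 R (fun s : R => sw s - h s)
    (fun s : R => sdw s - dh s) 0 t t0).
  - by apply: continuous_subspaceT => s; apply: continuousB; [exact: csw|exact: ch].
  - by move=> s s0 _; apply: is_derive_fun_sub; [exact: dsw|exact: dh_].
  - by move=> s s0 _; rewrite subr_le0 le.
rewrite ler_norml lerNl; apply/andP; split.
  apply: (bound (fun s : R => - w s) (fun s : R => - dw s)).
  - by move=> s; apply: continuousN; exact: cw.
  - by rewrite w0 oppr0.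
  - by move=> s s0; apply: is_derive_fun_opp; exact: dw_.
  - by move=> s /dwh; apply: le_trans; rewrite -normrN ler_norm.
apply: (bound w dw) => // s /dwh; apply: le_trans; exact: ler_norm.
Qed.

Lemma le0_of_le_geometric (x K : R) : (forall n, x <= K * 2^-1 ^+ n) -> x <= 0.
Proof.
move=> H; have := @cvg_geometric R K 2^-1.
rewrite ger0_norm ?invr_ge0// invf_lt1// ltr1n => /(_ isT) cv.
have := cvg_lim (@Rhausdorff R) cv => <-.
apply: limr_ge; first by apply/cvg_ex; eexists; exact: cv.
by near=> n; exact: H.
Unshelve. all: by end_near. Qed.

(** [a n - e n] is nondecreasing, [a n + e n] nonincreasing, where
    [e n = 2 * B * 2^-1 ^+ n]; the limit is the common bound of the two. *)
Lemma geometric_limit (a : nat -> R) (B : R) :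
  (forall n, `|a n.+1 - a n| <= B * 2^-1 ^+ n) ->
  exists l, forall n, `|a n - l| <= 2 * B * 2^-1 ^+ n.
Proof.
move=> aB.
have B0 : 0 <= B by have := le_trans (normr_ge0 _) (aB 0%N); rewrite expr0 mulr1.
pose e n := 2 * B * 2^-1 ^+ n : R.
have eS n : e n.+1 = e n - B * 2^-1 ^+ n by rewrite /e exprS; field.
have e0 n : 0 <= e n by rewrite /e !mulr_ge0// exprn_ge0.
have lo n m : (n <= m)%N -> a n - e n <= a m - e m.
  elim: m => [|m ih]; first by rewrite leqn0 => /eqP ->.
  rewrite leq_eqVlt ltnS => /predU1P[-> //|/ih /le_trans]; apply.
  by move: (aB m); rewrite ler_norml eS => /andP[]; lra.
have hi n m : (n <= m)%N -> a m + e m <= a n + e n.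
  elim: m => [|m ih]; first by rewrite leqn0 => /eqP ->.
  rewrite leq_eqVlt ltnS => /predU1P[-> //|/ih]; apply: le_trans.
  by move: (aB m); rewrite ler_norml eS => /andP[]; lra.
have lohi n m : a n - e n <= a m + e m.
  have := lo n _ (leq_maxl n m); have := hi m _ (leq_maxr n m).
  have := e0 (maxn n m); lra.
pose S := range (fun n => a n - e n).
have hS : has_sup S.
  split; first by exists (a 0%N - e 0%N); exists 0%N.
  by exists (a 0%N + e 0%N) => _ [n _ <-].
exists (sup S) => n; rewrite -/(e n) distrC ler_distl.
apply/andP; split.
  by apply: ub_le_sup; [exact: (proj2 hS)|exists n].
by apply: ge_sup; [exact: (proj1 hS)|move=> _ [m _ <-]].
Qed.

End Comparison.

(** * Global solutions of Lipschitz systems *)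

Section LipschitzFields.
Context {R : realType} {I : finType}.
Implicit Types (phi psi : (I -> R) -> R) (F : (I -> R) -> I -> R).

Definition sum_lipschitz phi : Prop :=
  exists2 L : R, 0 <= L &
    forall u v : I -> R, `|phi u - phi v| <= L * \sum_j `|u j - v j|.

Lemma sum_lipschitz_continuous phi (u : I -> R -> R) : sum_lipschitz phi ->
  (forall i, continuous (u i)) -> continuous (fun t => phi (u ^~ t)).
Proof.
move=> [L L0 lip] cu t; apply/cvgrPdist_le => e e0.
pose e' := e / (L * #|I|%:R + 1).
have d0 : 0 < L * #|I|%:R + 1 by rewrite ltr_wpDl// mulr_ge0.
have e'0 : 0 < e' by rewrite divr_gt0.
near=> s; apply: (le_trans (lip _ _)).
apply: (@le_trans _ _ (L * \sum_(j : I) e')).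
  rewrite ler_wpM2l// ler_sum// => j _; move: j; near: s.
  apply: filter_forall => j; have /cvgrPdist_le := cu j t; exact.
rewrite sumr_const -mulr_natr -[leRHS](@divfK _ (L * #|I|%:R + 1)) ?gt_eqF//.
by rewrite -/e' mulrDr mulr1 mulrCA lerDl ltW.
Unshelve. all: by end_near. Qed.

Section Picard.
Variables (F : (I -> R) -> I -> R) (u0 : I -> R) (L : R).
Hypothesis L0 : 0 <= L.
Hypothesis lipF : forall i (u v : I -> R),
  `|F u i - F v i| <= L * \sum_j `|u j - v j|.

Fixpoint picard (n : nat) : I -> R -> R :=
  if n is m.+1
  then fun i t => u0 i + primitive (fun s => F (picard m ^~ s) i) t
  else fun i _ => u0 i.

(* [weight] dominates the first Picard step and absorbs the Lipschitz constant:
   its logarithmic derivative [rate] exceeds twice the constant of the field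
   for the sum norm. *)
Let rate := 2 * L * #|I|%:R + 1.
Let size0 := \sum_i `|F u0 i|.
Let weight (t : R) := size0 * expR (rate * t).

Let continuousF (u : I -> R -> R) i :
  (forall j, continuous (u j)) -> continuous (fun t => F (u ^~ t) i).
Proof.
by apply: (@sum_lipschitz_continuous (F ^~ i)); exists L => // v w; exact: lipF.
Qed.

Let continuous_step (u : I -> R -> R) i :
  (forall j, continuous (u j)) ->
  continuous (fun t => u0 i + primitive (fun s => F (u ^~ s) i) t).
Proof.
move=> cu t; have c := continuous_primitive (continuousF (i := i) cu) (x := t).
exact: (continuousD (@cst_continuous _ _ (u0 i) t) c).
Qed.

Let is_derive_step (u : I -> R -> R) i (t : R) :
  (forall j, continuous (u j)) -> 0 < t ->
  is_derive t 1 (fun t => u0 i + primitive (fun s => F (u ^~ s) i) t)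
    (F (u ^~ t) i).
Proof.
move=> cu t0.
have := is_derive_fun_add (is_derive_cst (u0 i) t 1)
  (is_derive_primitive (continuousF (i := i) cu) t0).
by rewrite add0r.
Qed.

Let continuous_picard n i : continuous (picard n i).
Proof.
elim: n i => [i t|n ih i]; first exact: cvg_cst.
exact: continuous_step.
Qed.

Let rate_gt0 : 0 < rate. Proof. by rewrite /rate ltr_wpDl// !mulr_ge0. Qed.

Let size0_ge0 : 0 <= size0. Proof. exact: sumr_ge0. Qed.

Let weight_ge0 t : 0 <= weight t.
Proof. by rewrite mulr_ge0// expR_ge0. Qed.

Let continuous_weight : continuous weight.
Proof.
move=> t.
exact: is_derive_continuous (is_derive_fun_scale size0 (is_derive_exp_scale rate t)).
Qed.

(** Picard's map is a contraction of ratio 1/2 for the distance weighted by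
    [weight], on the whole half-line at once; no gluing of local solutions is
    needed. *)
Let step_contracts (u v : I -> R -> R) i c (t : R) : 0 <= c ->
  (forall j, continuous (u j)) -> (forall j, continuous (v j)) ->
  (forall j s, 0 < s -> `|u j s - v j s| <= c * weight s) -> 0 <= t ->
  `|primitive (fun s => F (u ^~ s) i) t - primitive (fun s => F (v ^~ s) i) t|
    <= c / 2 * weight t.
Proof.
move=> c0 cu cv uv t0.
pose w (s : R) :=
  primitive (fun s => F (u ^~ s) i) s - primitive (fun s => F (v ^~ s) i) s.
apply: (@normr_le_of_derive R w (fun s => F (u ^~ s) i - F (v ^~ s) i)
  (fun s => c / 2 * weight s)
  (fun s => c / 2 * (size0 * (rate * expR (rate * s)))) t).
- move=> s; apply: continuousB; exact/continuous_primitive/continuousF.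
- by move=> s; apply: cvgMr; exact: continuous_weight.
- by rewrite /w !primitive0 subrr.
- by rewrite mulr_ge0// divr_ge0.
- by move=> s s0; apply: is_derive_fun_sub; apply: is_derive_primitive => //;
    exact: continuousF.
- move=> s s0; do 2 apply: is_derive_fun_scale; exact: is_derive_exp_scale.
- move=> s s0; apply: (le_trans (lipF _ _ _)).
  apply: (@le_trans _ _ (L * \sum_(j : I) c * weight s)).
    by rewrite ler_wpM2l// ler_sum// => j _; exact: uv.
  rewrite sumr_const -[leLHS]addr0.
  have -> : c / 2 * (size0 * (rate * expR (rate * s))) =
      L * (c * weight s *+ #|I|) + c / 2 * weight s.
    by rewrite -(mulr_natr (c * _)) /weight; set E := expR _; rewrite /rate; field.
  by rewrite lerD2l mulr_ge0// divr_ge0.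
- exact: t0.
Qed.

Let first_step i (t : R) : 0 <= t -> `|picard 1 i t - picard 0 i t| <= weight t.
Proof.
move=> t0 /=; rewrite addrC addKr.
apply: (@normr_le_of_derive R (primitive (fun=> F u0 i)) (fun=> F u0 i) weight
  (fun s => size0 * (rate * expR (rate * s)))) => //.
- by apply: continuous_primitive => s; exact: cvg_cst.
- exact: primitive0.
- by move=> s s0; apply: is_derive_primitive => // r; exact: cvg_cst.
- by move=> s s0; apply: is_derive_fun_scale; exact: is_derive_exp_scale.
- move=> s s0; apply: (@le_trans _ _ size0).
    by rewrite /size0 (bigD1 i)//= lerDl sumr_ge0.
  rewrite ler_peMr// mulr_ege1//; last by rewrite -expR0 ler_expR mulr_ge0// ltW.
  by rewrite /rate lerDr !mulr_ge0.
Qed.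

Let picard_step n i (t : R) : 0 <= t ->
  `|picard n.+1 i t - picard n i t| <= 2^-1 ^+ n * weight t.
Proof.
elim: n i t => [i t /first_step|n ih i t t0]; first by rewrite expr0 mul1r.
rewrite /= opprD addrACA subrr add0r exprSr.
apply: step_contracts => //; first exact: @continuous_picard n.+1.
by move=> j s /ltW; exact: ih.
Qed.

Let picard_max n i t : picard n i t = picard n i (Num.max 0 t).
Proof. by case: n => //= n; rewrite /primitive maxA maxxx. Qed.

(** The iterates converge geometrically at every time, locally uniformly since
    [weight] is continuous; the limit is a fixed point by one more application
    of [step_contracts]. *)
Lemma picard_lindelof : exists u : I -> R -> R,
  [/\ forall i, continuous (u i), forall i, u i 0 = u0 i &
      forall i (t : R), 0 < t -> is_derive t 1 (u i) (F (u ^~ t) i)].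
Proof.
pose W (t : R) := weight (Num.max 0 t).
have W0 t : 0 <= W t by exact: weight_ge0.
have cW : continuous W.
  move=> t; apply: (@continuous_comp _ _ _ (fun s : R => Num.max 0 s) weight).
    by apply: continuous_max; [exact: cvg_cst|exact: cvg_id].
  exact: continuous_weight.
have /choice[u' hu'] (it : I * R) : exists l, forall n,
    `|picard n it.1 it.2 - l| <= 2 * W it.2 * 2^-1 ^+ n.
  case: it => i t /=; apply: geometric_limit => n.
  rewrite mulrC (picard_max n.+1) (picard_max n).
  by apply: picard_step; rewrite le_max lexx.
pose u i t := u' (i, t).
have hu n i t : `|picard n i t - u i t| <= 2 * W t * 2^-1 ^+ n := hu' (i, t) n.
have cu i : continuous (u i).
  move=> t; apply/cvgrPdist_le => e e0.
  (* [W t + 1] bounds [W] near [t], hence the same [n] serves for all [s]. *)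
  have small : \forall n \near \oo, 2 * (W t + 1) * 2^-1 ^+ n <= e / 3.
    have := @cvg_geometric R (2 * (W t + 1)) 2^-1.
    rewrite ger0_norm ?invr_ge0// invf_lt1// ltr1n => /(_ isT).
    move/cvgrPdist_le => /(_ (e / 3)); rewrite divr_gt0// => /(_ isT).
    apply: filterS => n; rewrite /geometric/= sub0r normrN.
    by apply: le_trans; exact: ler_norm.
  have [n /= hn] := filter_ex small.
  near=> s.
  have Ws : W s <= W t + 1.
    suff : `|W t - W s| <= 1 by rewrite ler_norml => /andP[]; lra.
    by near: s; move/cvgrPdist_le : (cW t); exact.
  have p : `|picard n i t - picard n i s| <= e / 3.
    near: s; have /cvgrPdist_le := @continuous_picard n i t.
    by apply; rewrite divr_gt0.
  have ht : `|picard n i t - u i t| <= e / 3.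
    apply: le_trans (hu n i t) (le_trans _ hn).
    by rewrite ler_wpM2r ?exprn_ge0// ler_wpM2l// lerDl.
  have hs : `|picard n i s - u i s| <= e / 3.
    apply: le_trans (hu n i s) (le_trans _ hn).
    by rewrite ler_wpM2r ?exprn_ge0// ler_wpM2l.
  move: p ht hs; rewrite !ler_norml => /andP[? ?] /andP[? ?] /andP[? ?].
  by apply/andP; split; lra.
pose w i t := u0 i + primitive (fun s => F (u ^~ s) i) t.
have uw i t : 0 <= t -> u i t = w i t.
  move=> t0; apply/eqP; rewrite -subr_eq0 -normr_le0.
  apply: (@le0_of_le_geometric _ _ (2 * weight t)) => n.
  have Wt s : 0 <= s -> W s = weight s by move=> s0; rewrite /W (max_idPr _).
  have h1 : `|picard n.+1 i t - w i t| <= 2^-1 ^+ n * weight t.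
    rewrite /= opprD addrACA subrr add0r.
    rewrite (_ : 2^-1 ^+ n = 2 * 2^-1 ^+ n / 2); last by rewrite mulrC mulKf.
    apply: step_contracts => // j s /ltW s0.
    by rewrite mulrAC -Wt//; exact: hu.
  have h2 := hu n.+1 i t; rewrite Wt// exprS in h2.
  have -> : 2 * weight t * 2^-1 ^+ n =
    2 * weight t * (2^-1 * 2^-1 ^+ n) + 2^-1 ^+ n * weight t by field.
  rewrite -(subrKA (picard n.+1 i t)); apply: (le_trans (ler_normD _ _)).
  by rewrite lerD// distrC.
exists u; split => //.
- by move=> i; rewrite uw// /w primitive0 addr0.
- move=> i t t0; apply: (near_eq_is_derive _ (is_derive_step i cu t0)).
  near=> s; rewrite uw//; apply: ltW; near: s; exact: lt_nbhsr.
Unshelve. all: by end_near. Qed.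

End Picard.

End LipschitzFields.

(** * Smooth functions on boxes *)

Section Nonexpansive.
Context {R : realType}.
Implicit Types (p x y : R).

Lemma dist_max_le p x y : `|Num.max p x - Num.max p y| <= `|x - y|.
Proof.
have h1 := ler_norm (x - y); have h2 := ler_norm (y - x); rewrite distrC in h2.
have h0 := normr_ge0 (x - y); rewrite ler_norml.
by case: (leP p x); case: (leP p y) => ? ?; apply/andP; split; lra.
Qed.

Lemma dist_min_le p x y : `|Num.min p x - Num.min p y| <= `|x - y|.
Proof.
have h1 := ler_norm (x - y); have h2 := ler_norm (y - x); rewrite distrC in h2.
have h0 := normr_ge0 (x - y); rewrite ler_norml.
by case: (leP p x); case: (leP p y) => ? ?; apply/andP; split; lra.
Qed.

End Nonexpansive.

Section CoordinateCalculus.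
Context {R : realType} {N : nat}.
Implicit Types (g : 'rV[R]_N -> R) (u v x c : 'rV[R]_N) (i j : 'I_N).

Lemma set_action_id x i : set_action x i (x 0 i) = x.
Proof. by apply/rowP => j; rewrite mxE; case: eqP => [->|]. Qed.

Lemma is_derive_set_action g i x (a : R) :
  (forall y, derivable g y (delta_mx 0 i)) ->
  is_derive a 1 (fun b => g (set_action x i b)) (partial i g (set_action x i a)).
Proof.
move=> dg.
have shift (h : R) : set_action x i (h *: (1 : R) + a) =
    h *: delta_mx 0 i + set_action x i a.
  apply/rowP => j; rewrite !mxE eqxx /=; case: (j == i); last by rewrite mulr0 add0r.
  by [].
have := dg (set_action x i a); rewrite /partial /derivable /derive => cv.
split; rewrite ?/derivable ?/derive.
  by under eq_fun do rewrite /= shift.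
by under eq_fun do rewrite /= shift.
Qed.

Lemma partial_at_minimum g i x :
  (forall y, derivable g y (delta_mx 0 i)) ->
  (forall a, g x <= g (set_action x i a)) -> partial i g x = 0.
Proof.
move=> dg gmin; have d a := is_derive_set_action x a dg.
have lo : x 0 i - 1 <= x 0 i + 1 by lra.
have mid : x 0 i \in `]x 0 i - 1, x 0 i + 1[%R.
  by rewrite in_itv/=; apply/andP; split; lra.
have [_ D0] : is_derive (x 0 i) 1 (fun b => g (set_action x i b)) 0.
  apply: (derive1_at_min lo _ mid) => [t _|t _]; first by case: (d t).
  by rewrite set_action_id.
by have [_] := d (x 0 i); rewrite D0 set_action_id.
Qed.

Lemma mean_value_bound (h dh : R -> R) (M a b : R) :
  (forall s : R, is_derive s 1 h (dh s)) ->
  (forall s : R, Num.min a b <= s -> s <= Num.max a b -> `|dh s| <= M) ->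
  `|h b - h a| <= M * `|b - a|.
Proof.
move=> dh_; wlog ab : a b / a <= b.
  move=> W; case/orP: (le_total a b) => ab; first exact: W.
  rewrite minC maxC => B; rewrite -normrN opprB -[`|b - a|]normrN opprB.
  exact: W.
move=> B.
have hc : {within `[a, b], continuous h}.
  by apply: continuous_subspaceT => s; exact: is_derive_continuous (dh_ s).
have [s + ->] := MVT_segment ab (fun s _ => dh_ s) hc.
rewrite in_itv/= => /andP[sa sb]; rewrite normrM ler_wpM2r//.
by apply: B; rewrite ?(min_idPl _)// (max_idPr _).
Qed.

Definition box c (r : R) : set 'rV[R]_N :=
  [set v | forall j, `|v 0 j - c 0 j| <= r].

Lemma compact_box c r : compact (box c r).
Proof.
rewrite (_ : box c r = [set v | forall j,
    `[c 0 j - r, c 0 j + r]%classic (v ord0 j)]).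
  by apply: (@rV_compact R N (fun j => `[c 0 j - r, c 0 j + r]%classic)) => j;
    exact: segment_compact.
apply/seteqP; split => v /= H j; have := H j;
  by rewrite in_itv/= ler_distl.
Qed.

Lemma bounded_on_box g c r : continuous g ->
  exists M, forall v, box c r v -> `|g v| <= M.
Proof.
move=> cg; have := @continuous_compact _ _ g (box c r) (continuous_subspaceT cg)
  (@compact_box c r).
move/compact_bounded => [M [_ HM]]; exists (M + 1) => v bv.
by apply: (HM (M + 1)); [rewrite ltrDl|exists v].
Qed.

(** The partial derivatives are bounded on the compact box, and [v] is changed
    into [u] one coordinate at a time; every intermediate point lies in the box
    with [u] and [v]. *)
Lemma Ck1_lipschitz_on_box g c r : Ck 1 g ->
  exists2 L, 0 <= L & forall u v, box c r u -> box c r v ->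
    `|g u - g v| <= L * \sum_j `|u 0 j - v 0 j|.
Proof.
move=> [_ dg].
have /choice[M hM] j : exists M, forall v, box c r v -> `|partial j g v| <= M.
  by apply: bounded_on_box; have [_ []] := dg j.
pose L := \sum_j `|M j|.
have hL j v : box c r v -> `|partial j g v| <= L.
  move=> /hM/le_trans; apply; apply: (le_trans (ler_norm _)).
  by rewrite /L (bigD1 j)//= lerDl sumr_ge0.
exists L => [|u v bu bv]; first exact: sumr_ge0.
pose hybrid (s : seq 'I_N) : 'rV_N := \row_j (if j \in s then u 0 j else v 0 j).
have -> : u = hybrid (index_enum 'I_N).
  by apply/rowP => j; rewrite mxE mem_index_enum.
suff : forall s, `|g (hybrid s) - g v| <= L * \sum_(j <- s) `|u 0 j - v 0 j|.
  move=> /(_ (index_enum 'I_N)); congr (_ <= L * _).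
  by apply: eq_bigr => j _; rewrite mxE mem_index_enum.
elim=> [|i s ih].
  rewrite big_nil mulr0 (_ : hybrid [::] = v) ?subrr ?normr0//.
  by apply/rowP => j; rewrite mxE.
rewrite big_cons mulrDr -(subrKA (g (hybrid s))).
apply: (le_trans (ler_normD _ _)); rewrite lerD//.
have -> : hybrid (i :: s) = set_action (hybrid s) i (u 0 i).
  apply/rowP => j; rewrite !mxE in_cons.
  by case: eqP => [->|].
rewrite -{2}(set_action_id (hybrid s) i).
apply: (le_trans (mean_value_bound (M := L)
  (fun b => is_derive_set_action (hybrid s) b (dg i).1) _)).
  move=> a amin amax; apply: hL => j; rewrite !mxE.
  case: eqP => [->|_]; last by case: ifP.
  have := bu i; have := bv i; rewrite !ler_distl => /andP[v1 v2] /andP[u1 u2].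
  move: amin amax; rewrite mxE; case: ifP => _; first rewrite minxx maxxx => ? ?.
    by apply/andP; split; lra.
  by rewrite ge_min le_max => /orP[] ? /orP[] ?; apply/andP; split; lra.
rewrite ler_wpM2l ?sumr_ge0// mxE; case: ifP => // _.
by rewrite subrr normr0.
Qed.

(** The projection onto [box c r]. *)
Definition clip c (r : R) v : 'rV[R]_N :=
  \row_j (c 0 j + Num.max (- r) (Num.min r (v 0 j - c 0 j))).

Lemma clip_in_box c r v : 0 <= r -> box c r (clip c r v).
Proof.
move=> r0 j; rewrite mxE addrC addKr ler_norml le_max lexx/= ge_max ge_min lexx.
by rewrite andbT; lra.
Qed.

Lemma clip_id c r v : box c r v -> clip c r v = v.
Proof.
move=> bv; apply/rowP => j; rewrite mxE; move: (bv j).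
rewrite ler_norml => /andP[h1 h2].
by rewrite (min_idPr h2) (max_idPr h1) addrC subrK.
Qed.

Lemma clip_nonexpansive c r u v j :
  `|clip c r u 0 j - clip c r v 0 j| <= `|u 0 j - v 0 j|.
Proof.
rewrite !mxE -[leRHS](_ : `|(u 0 j - c 0 j) - (v 0 j - c 0 j)| = _); last first.
  by congr `|_|; ring.
rewrite opprD addrACA subrr add0r.
by apply: (le_trans (dist_max_le _ _ _)); exact: dist_min_le.
Qed.

End CoordinateCalculus.

(** * Saturation *)

Section Saturation.
Context {R : realType}.
Variable U : R.
Hypothesis U0 : 0 < U.
Implicit Types (s w : R).

Notation sat := (saturation U).

Lemma saturation_clamp s : sat s = Num.max (- U) (Num.min U s).
Proof.
have Upos := U0; rewrite /saturation; case: (ltgtP s 0) => [s0|s0|->].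
- rewrite ltr0_sg// mulN1r ltr0_norm//; case: (leP (- s) U) => h1;
    case: (leP U s) => h2; case: leP => h3; apply/le_anti/andP; split; lra.
- rewrite gtr0_sg// mul1r gtr0_norm//; case: (leP s U) => h1;
    case: (leP U s) => h2; case: leP => h3; apply/le_anti/andP; split; lra.
- by rewrite sgr0 mul0r; case: (leP U 0) => h1; case: leP => h3 //; lra.
Qed.

Lemma saturation_lipschitz s w : `|sat s - sat w| <= `|s - w|.
Proof.
rewrite !saturation_clamp; apply: (le_trans (dist_max_le _ _ _)).
exact: dist_min_le.
Qed.

Lemma saturation_le s : `|sat s| <= U.
Proof.
have Upos := U0.
rewrite saturation_clamp ler_norml le_max lexx/= ge_max ge_min lexx/=.
by rewrite andbT; lra.
Qed.

(** The variational inequality of a projection: [sat s] is the point of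
    [-U, U] closest to [s]. *)
Lemma saturation_variational s w : `|w| <= U -> 0 <= (s - sat s) * (sat s - w).
Proof.
have Upos := U0; rewrite ler_norml => /andP[w1 w2]; rewrite saturation_clamp.
case: (leP U s) => h1.
  by rewrite (max_idPr _); [rewrite mulr_ge0// subr_ge0|lra].
case: (leP (- U) s) => h2; first by rewrite subrr mul0r.
by rewrite mulr_le0// subr_le0// ltW.
Qed.

Lemma saturation0 : sat 0 = 0. Proof. by rewrite /saturation sgr0 mul0r. Qed.

Lemma sqr_saturation_le s : sat s ^+ 2 <= s * sat s.
Proof.
have := @saturation_variational s 0; rewrite normr0 => /(_ (ltW U0)); lra.
Qed.

Lemma saturation_ge s S : U <= S -> `|s| <= S -> U / S * `|s| <= `|sat s|.
Proof.
have Upos := U0 => US sS; have S0 : 0 < S by exact: lt_le_trans US.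
rewrite mulrAC ler_pdivrMr// saturation_clamp.
case: (leP U s) => h1.
  rewrite (max_idPr _); last by lra.
  by rewrite (gtr0_norm U0) ler_pM2l.
case: (leP (- U) s) => h2; first by rewrite mulrC ler_wpM2l.
by rewrite normrN (gtr0_norm U0) ler_pM2l.
Qed.

(** The primitive of [sat] that vanishes at 0: [s ^+ 2 / 2] on [-U, U], with
    slope [U] or [- U] beyond. *)
Definition sat_energy s : R := sat s * s - sat s ^+ 2 / 2.

Lemma is_derive_of_quadratic_gap (h : R -> R) (t a : R) :
  (forall k, `|h (t + k) - h t - a * k| <= k ^+ 2) -> is_derive t 1 h a.
Proof.
move=> gap.
have cv : (fun k : R => k^-1 *: (h (k *: (1 : R) + t) - h t)) @ 0^' --> a.
  apply/cvgrPdist_le => e e0; near=> k.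
  have k0 : k != 0 by near: k; exact: nbhs_dnbhs_neq.
  have ke : `|k| <= e by near: k; exact: dnbhs0_le.
  rewrite /GRing.scale /= mulr1 distrC [k + t]addrC.
  rewrite (_ : _ - a = k^-1 * (h (t + k) - h t - a * k)); last by field.
  rewrite normrM normfV ler_pdivrMl ?normr_gt0//; apply: (le_trans (gap k)).
  by rewrite -real_normK ?num_real// expr2 ler_wpM2l.
split; first by apply/cvg_ex; exists a.
exact: cvg_lim.
Unshelve. all: by end_near. Qed.

(** The gap between [sat_energy] and its tangent at [s] lies between 0 and
    [k ^+ 2 / 2], by the variational inequalities at [s] and at [s + k]; the
    points [U] and [- U] need no separate treatment. *)
Lemma is_derive_sat_energy s : is_derive s 1 sat_energy (sat s).
Proof.
apply: is_derive_of_quadratic_gap => k; rewrite /sat_energy.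
have h1 := saturation_variational s (saturation_le (s + k)).
have h2 := saturation_variational (s + k) (saturation_le s).
move: (sat s) (sat (s + k)) h1 h2 => p q h1 h2.
have h3 := sqr_ge0 (k - (q - p)); have h4 := sqr_ge0 (q - p).
have h5 := sqr_ge0 k.
by rewrite ler_norml; apply/andP; split; nra.
Qed.

Lemma sat_energy_ge s : s * sat s / 2 <= sat_energy s.
Proof. by have := sqr_saturation_le s; rewrite /sat_energy; lra. Qed.

Lemma sat_energy_le s : sat_energy s <= s ^+ 2 / 2.
Proof. by have := sqr_ge0 (s - sat s); rewrite /sat_energy; lra. Qed.

Lemma mul_saturation_ge0 s : 0 <= s * sat s.
Proof. by apply: le_trans (sqr_saturation_le s); exact: sqr_ge0. Qed.

Lemma mul_saturation s : s * sat s = `|s| * `|sat s|.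
Proof. by rewrite -normrM ger0_norm// mul_saturation_ge0. Qed.

End Saturation.

(** * Exponential decay *)

Section Decay.
Context {R : realType}.

Lemma le_of_nonincreasing (h dh : R -> R) (a b : R) :
  (forall t : R, 0 < t -> is_derive t 1 h (dh t)) ->
  0 < a -> (forall t : R, a < t -> dh t <= 0) -> a <= b -> h b <= h a.
Proof.
move=> dh_ a0 neg ab; apply: (le_of_derive_le0 (dh := dh) ab).
- apply: continuous_in_subspaceT => t /[!inE]/= /[!in_itv]/= /andP[ta _].
  exact: is_derive_continuous (dh_ _ (lt_le_trans a0 ta)).
- by move=> t ta _; apply: dh_; exact: lt_trans ta.
- by move=> t ta _; exact: neg.
Qed.

(** The function [h t * expR (c * t)], corrected by a multiple of
    [expR ((c - k) * t)] that absorbs the forcing term, is nonincreasing. *)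
Lemma exponential_decay (h dh : R -> R) (c k A : R) : 0 < c -> 2 * c <= k ->
  0 <= A -> (forall t : R, 0 < t -> is_derive t 1 h (dh t)) ->
  (forall t : R, 1 < t -> dh t <= - c * h t + A * expR (- k * t)) ->
  exists M, forall t, 1 <= t -> h t <= M * expR (- c * t).
Proof.
move=> c0 ck A0 dh_ ineq.
pose G (t : R) := h t * expR (c * t) + A / (k - c) * expR ((c - k) * t).
pose dG (t : R) := (h t * (c * expR (c * t)) + expR (c * t) * dh t) +
  A / (k - c) * ((c - k) * expR ((c - k) * t)).
exists (G 1) => t t1.
have kc : k - c != 0 by apply/eqP; lra.
have decr : G t <= G 1.
  apply: (@le_of_nonincreasing G dG) => // s s1.
    apply: is_derive_fun_add.
      by apply: is_derive_fun_mul; [exact: dh_|exact: is_derive_exp_scale].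
    by apply: is_derive_fun_scale; exact: is_derive_exp_scale.
  have E : expR ((c - k) * s) = expR (c * s) * expR (- k * s).
    by rewrite -expRD; congr expR; ring.
  rewrite /dG E [X in X <= 0](_ : _ =
     expR (c * s) * (dh s - (- c * h s + A * expR (- k * s)))); last by field.
  by rewrite mulr_ge0_le0 ?expR_ge0// subr_le0 ineq.
have -> : h t = h t * expR (c * t) * expR (- c * t).
  by rewrite -mulrA -expRD mulNr subrr expR0 mulr1.
rewrite ler_wpM2r ?expR_ge0//; apply: le_trans decr; rewrite lerDl.
by rewrite mulr_ge0 ?expR_ge0// divr_ge0//; lra.
Qed.

Lemma cvg0_of_sqr_decay (h : R -> R) (c M : R) : 0 < c ->
  (forall t, 1 <= t -> h t ^+ 2 <= M * expR (- c * t)) ->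
  h t @[t --> +oo] --> (0 : R).
Proof.
move=> c0 H; apply/cvgrPdist_le => e e0; near=> t.
rewrite sub0r normrN -(@ler_pXn2r _ 2)// ?nnegrE ?(ltW e0)//.
rewrite real_normK ?num_real//.
have t1 : 1 <= t by near: t; exact: nbhs_pinfty_ge.
apply: (le_trans (H t t1)).
have M0 : 0 <= M.
  have := le_trans (sqr_ge0 _) (H 1 (lexx _)).
  by rewrite pmulr_lge0// expR_gt0.
rewrite mulNr expRN ler_pdivrMr ?expR_gt0//.
have h1 : M / (e ^+ 2 * c) <= t by near: t; apply: nbhs_pinfty_ge; exact: num_real.
have h2 : c * t <= expR (c * t) by have := expR_ge1Dx (c * t); lra.
apply: (@le_trans _ _ (e ^+ 2 * (c * t))); last by rewrite ler_wpM2l// sqr_ge0.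
by move: h1; rewrite ler_pdivrMr ?mulr_gt0 ?exprn_gt0// => /le_trans; apply; nra.
Unshelve. all: by end_near. Qed.

End Decay.

(** * The perturbed saturated double integrator *)

Section SaturatedDoubleIntegrator.
Context {R : realType}.
Variables (U C k : R) (x v d : R -> R).
Hypotheses (U0 : 0 < U) (C0 : 0 <= C) (k0 : 0 < k).
Hypothesis dx : forall t : R, 0 < t -> is_derive t 1 x (v t).
Hypothesis dv : forall t : R, 0 < t ->
  is_derive t 1 v (- saturation U (x t + v t + d t)).
Hypothesis d_decay : forall t : R, 0 < t -> `|d t| <= C * expR (- k * t).

Let s (t : R) := x t + v t.
Let p (t : R) := saturation U (s t).
Let delta (t : R) := p t - saturation U (s t + d t).
Let D (t : R) := C * expR (- k * t).

Let delta_le (t : R) : 0 < t -> `|delta t| <= D t.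
Proof.
move=> t0; apply: le_trans (d_decay t0).
apply: (le_trans (saturation_lipschitz U0 _ _)).
by rewrite opprD addrA subrr add0r normrN.
Qed.

Let is_derive_v (t : R) : 0 < t -> is_derive t 1 v (delta t - p t).
Proof.
move=> t0; rewrite (_ : delta t - p t = - saturation U (s t + d t)).
  exact: dv.
by rewrite /delta addrAC subrr add0r.
Qed.

Let is_derive_s (t : R) : 0 < t -> is_derive t 1 s (v t + (delta t - p t)).
Proof. by move=> t0; apply: is_derive_fun_add; [exact: dx|exact: is_derive_v]. Qed.

(* In the variables [v] and [s = x + v], the power of the feedback is
   [- p ^+ 2]: the terms in [v * p] cancel. *)
Let energy (t : R) := 2^-1 * v t ^+ 2 + sat_energy U (s t).

Let denergy (t : R) := delta t * (v t + p t) - p t ^+ 2.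

Let is_derive_energy (t : R) : 0 < t -> is_derive t 1 energy (denergy t).
Proof.
move=> t0; have := is_derive_fun_add
  (is_derive_fun_scale 2^-1 (is_derive_fun_sqr (is_derive_v t0)))
  (is_derive_fun_comp (is_derive_s t0) (is_derive_sat_energy U0 (s t))).
rewrite [X in is_derive _ _ _ X](_ : _ = denergy t)//.
by rewrite /denergy -/(p t); field.
Qed.

Let sat_energy_ge0 r : 0 <= sat_energy U r.
Proof.
apply: le_trans (sat_energy_ge U0 r).
by rewrite divr_ge0// mul_saturation_ge0.
Qed.

(** The perturbation being integrable, the energy stays bounded:
    [energy' <= D * (1 + U + 2 * energy)], and multiplying by the exponential
    of [2 / k * D], a primitive of [- 2 * D], absorbs the right-hand side. *)
Let energy_bounded : exists B, forall t, 1 <= t -> energy t <= B.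
Proof.
pose Q (t : R) := 1 + U + 2 * energy t.
pose W (t : R) := expR (2 / k * D t).
pose dW (t : R) := W t * (2 / k * (C * (- k * expR (- k * t)))).
pose dQ (t : R) := 0 + 2 * denergy t.
have dG (t : R) : 0 < t ->
    is_derive t 1 (fun r => Q r * W r) (Q t * dW t + W t * dQ t).
  move=> t0; apply: is_derive_fun_mul.
    apply: is_derive_fun_add.
    by apply: is_derive_fun_scale; exact: is_derive_energy.
  apply: is_derive_fun_comp.
  by do 2 apply: is_derive_fun_scale; exact: is_derive_exp_scale.
have E0 (t : R) : 0 <= energy t.
  by rewrite addr_ge0// mulr_ge0// ?sqr_ge0// invr_ge0.
have W1 (t : R) : 1 <= W t.
  rewrite /W -expR0 ler_expR !mulr_ge0 ?expR_ge0//.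
  by rewrite invr_ge0 ltW.
have neg (t : R) : 0 < t -> Q t * dW t + W t * dQ t <= 0.
  move=> t0; rewrite [X in X <= 0](_ : _ = W t * (2 * (denergy t - D t * Q t))).
    have := delta_le t0; move: (W1 t) => w1 dl.
    rewrite mulr_ge0_le0//; first by apply: le_trans w1.
    rewrite mulr_ge0_le0// subr_le0 /denergy.
    apply: (@le_trans _ _ (delta t * (v t + p t))); first by rewrite gerBl sqr_ge0.
    apply: (le_trans (ler_norm _)); rewrite normrM ler_pM//.
    apply: (le_trans (ler_normD _ _)).
    have := saturation_le U0 (s t); have := sat_energy_ge0 (s t).
    rewrite /Q /energy -/(p t); have := sqr_ge0 (`|v t| - 1).
    rewrite -[v t ^+ 2]real_normK ?num_real//; move: (`|v t|) (`|p t|) => a b.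
    nra.
  rewrite /dW /dQ /D; field; exact: lt0r_neq0.
exists (Q 1 * W 1) => t t1.
have := @le_of_nonincreasing _ _ _ 1 t dG ltr01 _ t1.
move=> /(_ (fun r r1 => neg r (lt_trans ltr01 r1))).
apply: le_trans; apply: (@le_trans _ _ (Q t)).
  by rewrite /Q; have := E0 t; have := U0; lra.
by rewrite ler_peMr//; have := E0 t; have := U0; rewrite /Q; lra.
Qed.

(** Once [s] and [v] are bounded, [sat] dominates a linear gain on the range of
    [s], and subtracting a small multiple of the cross term [s * v] from the
    energy yields a function [h] equivalent to [s ^+ 2 + v ^+ 2] that decays
    exponentially, up to the perturbation. *)
Lemma saturated_double_integrator_cvg0 : x t @[t --> +oo] --> (0 : R).
Proof.
have [B hB] := energy_bounded.
have B0 : 0 <= B.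
  apply: le_trans (hB 1 (lexx _)).
  by rewrite addr_ge0// mulr_ge0// ?sqr_ge0// invr_ge0.
have Epos := sat_energy_ge0.
have v_le t : 1 <= t -> v t ^+ 2 <= 2 * B.
  by move=> /hB; rewrite /energy; have := Epos (s t); lra.
have sp_le t : 1 <= t -> `|s t| * `|p t| <= 2 * B.
  move=> /hB; rewrite /energy -mul_saturation//.
  by have := sat_energy_ge U0 (s t); have := sqr_ge0 (v t); lra.
pose S := 1 + U + 2 * B + 2 * B / U.
have BU0 : 0 <= 2 * B / U by rewrite divr_ge0 ?mulr_ge0// ltW.
have Upos := U0.
have US : U <= S by rewrite /S; lra.
have S0 : 0 < S by lra.
have v_S t : 1 <= t -> `|v t| <= S.
  move=> /v_le; rewrite -[v t ^+ 2]real_normK ?num_real// /S.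
  by have := sqr_ge0 (`|v t| - 1); nra.
have s_S t : 1 <= t -> `|s t| <= S.
  move=> /sp_le spB; have [sU|Us] := leP `|s t| U; first exact: le_trans US.
  apply: (@le_trans _ _ (2 * B / U)); last by rewrite /S; lra.
  rewrite ler_pdivlMr//; apply: le_trans spB; rewrite ler_wpM2l//.
  have := saturation_ge U0 (ltW Us) (lexx _); rewrite divfK//.
  by rewrite gt_eqF// (lt_trans U0).
(* The gain of [sat] on the interval [-S, S], where [s] and [v] live. *)
pose a := U / S.
have a0 : 0 < a by rewrite divr_gt0.
have a1 : a <= 1 by rewrite ler_pdivrMr// mul1r.
have gain t : 1 <= t -> a * `|s t| <= `|p t|.
  by move=> t1; apply: saturation_ge => //; exact: s_S.
(* The rate is limited by the damping of [s], by that of [v] and by the decay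
   of the perturbation. *)
pose c := Num.min (a ^+ 2 / 8) (k / 2).
have c0 : 0 < c by rewrite lt_min !divr_gt0// exprn_gt0.
have ca : c <= a ^+ 2 / 8 by rewrite ge_min lexx.
have ck : 2 * c <= k.
  have : c <= k / 2 by rewrite ge_min lexx orbT.
  lra.
pose h (t : R) := energy t - a / 4 * (s t * v t).
pose dh (t : R) := denergy t -
  a / 4 * (s t * (delta t - p t) + v t * (v t + (delta t - p t))).
have dh_ (t : R) : 0 < t -> is_derive t 1 h (dh t).
  move=> t0; apply: is_derive_fun_sub; first exact: is_derive_energy.
  apply: is_derive_fun_scale; apply: is_derive_fun_mul.
    exact: is_derive_s.
  exact: is_derive_v.
have facts t : 1 <= t -> a ^+ 2 * s t ^+ 2 <= p t ^+ 2 /\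
    a * s t ^+ 2 <= s t * p t /\ a * (s t * p t) <= p t ^+ 2.
  move=> t1; have := gain t t1; rewrite mul_saturation//.
  rewrite -[s t ^+ 2]real_normK ?num_real// -[p t ^+ 2]real_normK ?num_real//.
  rewrite -/(p t); move: (normr_ge0 (s t)) (normr_ge0 (p t)).
  move: (`|s t|) (`|p t|) => X P X0 P0 XP.
  have q0 : 0 <= P - a * X by rewrite subr_ge0.
  have q1 := mulr_ge0 X0 q0; have q2 := mulr_ge0 P0 q0.
  have q3 := mulr_ge0 (ltW a0) q1.
  by split; last split; lra.
have ineq (t : R) : 1 < t -> dh t <= - c * h t + 4 * S * C * expR (- k * t).
  move=> /ltW t1; have t0 : 0 < t by exact: lt_le_trans t1.
  have [f1 [f2 f3]] := facts t t1.
  have noise : delta t * (v t + p t - a / 4 * (s t + v t)) <= 4 * S * D t.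
    apply: (le_trans (ler_norm _)); rewrite normrM mulrC ler_pM//; last first.
      exact: delta_le.
    have := v_S t t1; have := s_S t t1.
    have := le_trans (saturation_le U0 (s t)) US.
    rewrite -/(p t) !ler_norml => /andP[? ?] /andP[? ?] /andP[? ?].
    by apply/andP; split; nra.
  have main : - p t ^+ 2 - a / 4 * (v t ^+ 2 - v t * p t - s t * p t) <= - c * h t.
    have := sat_energy_le U (s t); rewrite /h /energy.
    move: (sat_energy U (s t)) => Phi Phile.
    have q1 : a / 4 * (v t * p t) <= a / 4 * ((v t ^+ 2 + p t ^+ 2) / 2).
      by rewrite ler_wpM2l ?divr_ge0 ?(ltW a0)//; have := sqr_ge0 (v t - p t); lra.
    have q2 : c * (2^-1 * v t ^+ 2 + Phi - a / 4 * (s t * v t)) <=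
        a ^+ 2 / 8 * (v t ^+ 2 + s t ^+ 2).
      apply: (@le_trans _ _ (c * (v t ^+ 2 + s t ^+ 2))).
        rewrite ler_pM2l//; have := sqr_ge0 (v t + s t); have := sqr_ge0 (v t - s t).
        by nra.
      by rewrite ler_wpM2r// addr_ge0// sqr_ge0.
    have q3 : a ^+ 2 * v t ^+ 2 <= a * v t ^+ 2.
      by rewrite ler_wpM2r ?sqr_ge0// expr2 ler_piMr// ltW.
    have q4 : a * p t ^+ 2 <= p t ^+ 2 by rewrite ler_piMl ?sqr_ge0.
    have := sqr_ge0 (p t); nra.
  move: noise main; rewrite /dh /denergy /D; lra.
have A0 : 0 <= 4 * S * C by rewrite !mulr_ge0// ltW.
have [M hM] := exponential_decay c0 ck A0 dh_ ineq.
apply: (@cvg0_of_sqr_decay _ _ c (8 / a * M) c0) => t t1.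
apply: (@le_trans _ _ (8 / a * h t)); last first.
  by rewrite -[leRHS]mulrA; apply: ler_wpM2l; [rewrite divr_ge0// ltW|exact: hM].
have -> : x t = s t - v t by rewrite /s addrK.
rewrite mulrAC ler_pdivlMr// /h /energy.
have [_ [f2 _]] := facts t t1; have := sat_energy_ge U0 (s t); rewrite -/(p t).
have e1 := sqr_ge0 (v t + s t); have e2 := sqr_ge0 (v t - s t).
have e3 : 0 <= a * (v t + s t) ^+ 2 by rewrite mulr_ge0// ltW.
have e4 : 0 <= a * (v t - s t) ^+ 2 by rewrite mulr_ge0// ltW.
have e5 : a * v t ^+ 2 <= v t ^+ 2 by rewrite ler_piMl ?sqr_ge0.
lra.
Qed.

End SaturatedDoubleIntegrator.

(** * Finite sums *)

Section FiniteSums.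
Context {R : realType}.

Lemma ler_sum_term (I : finType) (F : I -> R) i :
  (forall j, 0 <= F j) -> F i <= \sum_j F j.
Proof. by move=> F0; rewrite (bigD1 i)//= lerDl sumr_ge0. Qed.

Lemma sqr_sum_le (I : finType) (u : I -> R) :
  (\sum_i u i) ^+ 2 <= #|I|%:R * \sum_i u i ^+ 2.
Proof.
have half : \sum_i \sum_(j : I) 2^-1 * u i ^+ 2 =
    2^-1 * (#|I|%:R * \sum_i u i ^+ 2).
  rewrite (eq_bigr (fun i => 2^-1 * u i ^+ 2 *+ #|I|)) => [|i _]; last first.
    by rewrite sumr_const.
  by rewrite sumrMnl -mulr_sumr mulr_natl mulrnAr.
have -> : #|I|%:R * \sum_i u i ^+ 2 =
    \sum_i \sum_(j : I) 2^-1 * u i ^+ 2 + \sum_(i : I) \sum_j 2^-1 * u j ^+ 2.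
  by rewrite [X in _ = _ + X]exchange_big/= half; field.
rewrite expr2 mulr_suml -big_split/=; apply: ler_sum => i _.
rewrite mulr_sumr -big_split/=; apply: ler_sum => j _.
by have := sqr_ge0 (u i - u j); lra.
Qed.

Lemma positive_lower_bound (I : finType) (u : I -> R) : (forall i, 0 < u i) ->
  exists2 c, 0 < c & forall i, c <= u i.
Proof.
move=> u0; have s0 i : 0 <= (u i)^-1 by rewrite invr_ge0 ltW.
exists (1 + \sum_i (u i)^-1)^-1; first by rewrite invr_gt0 ltr_pwDl// sumr_ge0.
move=> i; rewrite -[leRHS]invrK lef_pV2 ?posrE ?invr_gt0//.
  by apply: (le_trans (ler_sum_term i s0)); rewrite lerDr.
by rewrite ltr_pwDl// sumr_ge0.
Qed.

End FiniteSums.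

(** * The grounded Laplacian of a connected graph *)

Section GroundedLaplacian.
Context {R : realType} {N : nat}.
Variable e : rel 'I_N.
Hypothesis e_sym : symmetric e.
Notation adj := (@adjacency N R e).

(** The quadratic form of the Laplacian plus the diagonal matrix whose entries
    are the [adj i j]; it governs the estimates of the action of player [j]. *)
Definition grounded_form (j : 'I_N) (b : 'I_N -> R) : R :=
  \sum_i b i * (\sum_k adj i k * (b i - b k) + adj i j * b i).

(** Exchanging the two ends of each edge symmetrizes the double sum. *)
Lemma grounded_formE j b : 2 * grounded_form j b =
  \sum_i \sum_k adj i k * (b i - b k) ^+ 2 + 2 * \sum_i adj i j * b i ^+ 2.
Proof.
have -> : grounded_form j b = \sum_i \sum_k adj i k * (b i * (b i - b k)) +
    \sum_i adj i j * b i ^+ 2.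
  rewrite -big_split; apply: eq_bigr => i _ /=; rewrite mulrDr mulr_sumr.
  by congr (_ + _); [apply: eq_bigr => k _|]; ring.
rewrite mulrDr; congr (_ + _).
have E : \sum_i \sum_k adj i k * (b i * (b i - b k)) =
    \sum_i \sum_k adj i k * (b k * (b k - b i)).
  rewrite exchange_big/=; apply: eq_bigr => i _; apply: eq_bigr => k _.
  by rewrite /adjacency e_sym.
rewrite mulrDl mul1r {2}E -big_split/=; apply: eq_bigr => i _.
by rewrite -big_split/=; apply: eq_bigr => k _; ring.
Qed.

Let adj_ge0 i k : 0 <= adj i k. Proof. exact: ler0n. Qed.

Let edge_le j b i k : e i k -> (b i - b k) ^+ 2 <= 2 * grounded_form j b.
Proof.
move=> eik; rewrite grounded_formE.
have t0 i' k' : 0 <= adj i' k' * (b i' - b k') ^+ 2 by rewrite mulr_ge0// sqr_ge0.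
apply: (@le_trans _ _ (\sum_k adj i k * (b i - b k) ^+ 2)).
  by apply: le_trans (ler_sum_term k (t0 i)); rewrite /adjacency eik mul1r.
apply: le_trans (ler_sum_term i (fun i' => sumr_ge0 _ (fun k _ => t0 i' k))) _.
by rewrite lerDl mulr_ge0// sumr_ge0// => i' _; rewrite mulr_ge0// sqr_ge0.
Qed.

Let neighbour_le j b i : e i j -> b i ^+ 2 <= grounded_form j b.
Proof.
move=> eij; rewrite -(ler_pM2l (ltr0n R 2)) grounded_formE.
have t0 i' : 0 <= adj i' j * b i' ^+ 2 by rewrite mulr_ge0// sqr_ge0.
have t1 : 0 <= \sum_i \sum_k adj i k * (b i - b k) ^+ 2.
  by apply: sumr_ge0 => i' _; apply: sumr_ge0 => k _; rewrite mulr_ge0// sqr_ge0.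
have := ler_sum_term i t0; rewrite {1}/adjacency eij mul1r; lra.
Qed.

Let grounded_form_ge0 j b : 0 <= grounded_form j b.
Proof.
rewrite -(pmulr_rge0 _ (ltr0n R 2)) grounded_formE.
apply: addr_ge0; last first.
  by rewrite mulr_ge0// sumr_ge0// => i _; rewrite mulr_ge0// sqr_ge0.
by apply: sumr_ge0 => i _; apply: sumr_ge0 => k _; rewrite mulr_ge0// sqr_ge0.
Qed.

(** The coordinate at a neighbour of [j] is controlled by the grounding term,
    and the control spreads along edges; the graph being connected, it reaches
    every node. *)
Lemma grounded_form_coercive : (2 <= N)%N -> connected_graph e ->
  exists2 l, 0 < l & forall j b, l * \sum_i b i ^+ 2 <= grounded_form j b.
Proof.
move=> N2 conn.
(* By induction along a path, each edge [k -- k'] turning a bound [C] at [k]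
   into the bound [2 * C + 4] at [k']. *)
have /choice[C hC] (ji : 'I_N * 'I_N) : exists C, 0 <= C /\
    forall b, b ji.2 ^+ 2 <= C * grounded_form ji.1 b.
  case: ji => j i /=.
  have [k ekj] : exists k, e k j.
    have [i' ij] : exists i' : 'I_N, i' != j.
      have : (0 < #|[pred i' | i' != j]|)%N.
        by have := cardC1 j; rewrite card_ord => ->; rewrite -ltnS prednK// ltnW.
      by move/card_gt0P => [i' ?]; exists i'.
    have /connectP[[|k s] /=] := conn j i'.
      by move=> _ E; rewrite E eqxx in ij.
    by move=> /andP[ejk _] _; exists k; rewrite e_sym.
  have : exists C, 0 <= C /\ forall b, b k ^+ 2 <= C * grounded_form j b.
    by exists 1; split=> // b; rewrite mul1r; exact: neighbour_le.
  have /connectP[s] := conn k i; elim: s k {ekj} => [k _ -> //|k' s ih k].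
  move=> /= /andP[ekk' ps] li [C [C0 hC]]; apply: (ih k' ps li).
  exists (2 * C + 4); split=> [|b]; first by rewrite addr_ge0// mulr_ge0.
  have := hC b; have := edge_le j b ekk'; have := sqr_ge0 (2 * b k - b k').
  by nra.
pose S := 1 + \sum_ji C ji.
have C0 ji : 0 <= C ji by have [] := hC ji.
have S0 : 0 < S by rewrite ltr_pwDl// sumr_ge0.
exists (S * N%:R)^-1.
  by rewrite invr_gt0 mulr_gt0// ltr0n ltnW.
move=> j b; rewrite ler_pdivrMl ?mulr_gt0 ?ltr0n ?(ltnW N2)//.
rewrite (_ : S * N%:R * _ = \sum_(i < N) S * grounded_form j b); last first.
  by rewrite sumr_const card_ord -mulr_natl; ring.
apply: ler_sum => i _; apply: (le_trans ((hC (j, i)).2 b)).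
rewrite ler_wpM2r// (le_trans (ler_sum_term (j, i) C0))//.
by rewrite /S lerDr.
Qed.

End GroundedLaplacian.

(** * The dissipation inequality *)

Section Dissipation.
Context {R : realType} {N : nat}.
Variables (e : rel 'I_N) (m l L : R) (K : 'I_N -> R) (thb : 'I_N -> 'I_N -> R).
Hypotheses (N0 : (0 < N)%N) (m0 : 0 < m) (l0 : 0 < l) (L0 : 0 <= L).
Hypotheses (hK : forall i, 0 < K i) (hthb : forall i j, 0 < thb i j).
Hypothesis coercive : forall j b,
  l * \sum_i b i ^+ 2 <= grounded_form e j b.

(** The rate of the Lyapunov function in the slow time: [a] is the tracking
    error of [z], [b] the estimation error of [y] and [g] the gradients
    evaluated at the estimates. *)
Definition dissipation (th : R) (a g : 'I_N -> R) (b : 'I_N -> 'I_N -> R) : R :=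
  - \sum_i a i * g i - th * \sum_j grounded_form e j (b ^~ j)
  + \sum_i \sum_j b i j * (K j * g j / thb i j).

(** With the norms [al] and [be] below, the three indefinite terms are at most
    [c * al * be + c * be ^+ 2]. Half of the monotonicity term absorbs the part
    of [c * al * be] in [al], and the grounded forms, multiplied by [th], absorb
    everything in [be]. *)
Lemma dissipation_le : exists2 th0, 0 < th0 & forall th a g b, th0 <= th ->
  - \sum_i a i * g i <= - m * \sum_i a i ^+ 2 +
     \sum_i `|a i| * (L * \sum_j `|b i j|) ->
  (forall i, `|g i| <= L * \sum_j (`|b i j| + `|a j|)) ->
  dissipation th a g b <=
    - (m / 2) * (\sum_i a i ^+ 2 + \sum_i \sum_j b i j ^+ 2).
Proof.
pose W := \sum_i \sum_j K j / thb i j.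
pose n : R := N%:R.
pose c := L * (1 + W).
pose q := n * c ^+ 2 / (2 * m).
pose th0 := (n ^+ 2 * (q + c) + m) / l.
have w0 i j : 0 <= K j / thb i j by rewrite divr_ge0// ltW.
have W0 : 0 <= W by apply: sumr_ge0 => i _; exact: sumr_ge0.
have c0 : 0 <= c by rewrite mulr_ge0// addr_ge0.
have n0 : 0 < n by rewrite ltr0n.
have q0 : 0 <= q.
  apply: divr_ge0; first exact: mulr_ge0 (ltW n0) (sqr_ge0 _).
  by rewrite mulr_ge0// ltW.
have th00 : 0 < th0.
  by rewrite divr_gt0// ltr_wpDl// mulr_ge0 ?sqr_ge0// addr_ge0.
exists th0 => //.
move=> th a g b th_ge H1 H2.
pose A := \sum_i a i ^+ 2; pose B := \sum_i \sum_j b i j ^+ 2.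
pose al := \sum_i `|a i|; pose be := \sum_i \sum_j `|b i j|.
have al0 : 0 <= al by exact: sumr_ge0.
have be0 : 0 <= be by apply: sumr_ge0 => i _; exact: sumr_ge0.
have row_be i : \sum_j `|b i j| <= be.
  by apply: (@ler_sum_term _ _ (fun i => \sum_j `|b i j|)) => k; exact: sumr_ge0.
have g_le i : `|g i| <= L * (be + al).
  apply: (le_trans (H2 i)); rewrite ler_wpM2l// big_split/= lerD//.
have alA : al ^+ 2 <= n * A.
  have := sqr_sum_le (fun i => `|a i|); rewrite card_ord => /le_trans; apply.
  by rewrite (eq_bigr _ (fun i _ => real_normK (num_real _))).
have beB : be ^+ 2 <= n ^+ 2 * B.
  have := sqr_sum_le (fun i => \sum_j `|b i j|); rewrite card_ord => /le_trans; apply.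
  rewrite expr2 -mulrA ler_wpM2l ?(ltW n0)// /B mulr_sumr ler_sum// => i _.
  have := sqr_sum_le (fun j => `|b i j|); rewrite card_ord => /le_trans; apply.
  by rewrite (eq_bigr _ (fun i _ => real_normK (num_real _))).
have T1 : \sum_i `|a i| * (L * \sum_j `|b i j|) <= L * al * be.
  rewrite mulrAC mulrC /al mulr_suml ler_sum// => i _.
  by rewrite ler_wpM2l// ler_wpM2l.
have T2 : \sum_i \sum_j b i j * (K j * g j / thb i j) <= be * (W * (L * (be + al))).
  rewrite /be mulr_suml ler_sum// => i _; rewrite mulr_suml ler_sum// => j _.
  apply: (le_trans (ler_norm _)); rewrite normrM ler_wpM2l//.
  rewrite mulrAC normrM (ger0_norm (w0 i j)) ler_pM//.
  apply: (@le_trans _ _ (\sum_j K j / thb i j)).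
    exact: (@ler_sum_term _ _ (fun j => K j / thb i j)).
  apply: (@ler_sum_term _ _ (fun i => \sum_j K j / thb i j)) => k.
  exact: sumr_ge0.
have T3 : l * B <= \sum_j grounded_form e j (b ^~ j).
  by rewrite /B exchange_big/= mulr_sumr ler_sum.
have thl : n ^+ 2 * (q + c) + m <= th * l by rewrite -ler_pdivrMr.
have B0 : 0 <= B by apply: sumr_ge0 => i _; apply: sumr_ge0 => j _; exact: sqr_ge0.
have A0 : 0 <= A by apply: sumr_ge0 => i _; exact: sqr_ge0.
have T4 : th * (l * B) <= th * \sum_j grounded_form e j (b ^~ j).
  by rewrite ler_wpM2l// (le_trans _ th_ge)// ltW.
have T5 : (n ^+ 2 * (q + c) + m) * B <= th * l * B by rewrite ler_wpM2r.
have cross : c * al * be <= m / 2 * A + n ^+ 2 * q * B.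
  have mn : 0 < 2 * m * n by rewrite !mulr_gt0.
  rewrite -(ler_pM2l mn).
  have -> : 2 * m * n * (m / 2 * A + n ^+ 2 * q * B) =
      m ^+ 2 * (n * A) + n ^+ 2 * c ^+ 2 * (n ^+ 2 * B).
    by rewrite /q; field; exact: lt0r_neq0.
  have h1 := ler_wpM2l (sqr_ge0 m) alA.
  have h2 := ler_wpM2l (mulr_ge0 (sqr_ge0 n) (sqr_ge0 c)) beB.
  have := sqr_ge0 (m * al - n * c * be); lra.
have T6 : L * W * be ^+ 2 <= c * (n ^+ 2 * B).
  by rewrite ler_pM ?mulr_ge0 ?sqr_ge0// /c ler_wpM2l// lerDr.
have mB : 0 <= m * B by rewrite mulr_ge0// ltW.
move: H1 T1 T2 T4 T5 cross T6; rewrite -/A /dissipation -/B /c.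
set X1 := \sum_i a i * g i; set X2 := \sum_i `|a i| * _.
set X3 := \sum_i \sum_j b i j * _; set X4 := th * \sum_j _; lra.
Qed.

End Dissipation.

(** * Lyapunov functions *)

Section LyapunovFunctions.
Context {R : realType}.
Implicit Types (V dV : R -> R).

Lemma is_derive_sqr_pos_part (r : R) :
  is_derive r 1 (fun s => Num.max 0 s ^+ 2) (2 * Num.max 0 r).
Proof.
apply: is_derive_of_quadratic_gap => k.
have := sqr_ge0 k; rewrite ler_norml.
case: (leP 0 (r + k)) => h1; case: (leP 0 r) => h2 h3; apply/andP; split; nra.
Qed.

(** Where [V] has reached [c] nothing is known of its derivative. Composing it
    with the C^1 nondecreasing function [v |-> - (max 0 (c - v)) ^ 2], which
    is constant beyond [c], gives a function that is nonincreasing on the whole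
    half-line. *)
Lemma sublevel_invariant V dV (c t : R) : continuous V ->
  (forall s : R, 0 < s -> is_derive s 1 V (dV s)) ->
  (forall s : R, 0 < s -> V s < c -> dV s <= 0) -> V 0 < c ->
  0 <= t -> V t <= V 0.
Proof.
move=> cV dV_ neg V0 t0.
pose h (s : R) := - Num.max 0 (c - V s) ^+ 2.
pose dh (s : R) := - (2 * Num.max 0 (c - V s) * (0 - dV s)).
have : h t <= h 0.
  apply: (@le_of_derive_le0 R h dh 0 t t0).
  - apply: continuous_subspaceT => s.
    apply: (@continuous_comp _ _ _ (fun s : R => c - V s)
      (fun r : R => - Num.max 0 r ^+ 2)).
      by apply: cvgB; [exact: cvg_cst|exact: cV].
    exact: is_derive_continuous (is_derive_fun_opp (is_derive_sqr_pos_part _)).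
  - move=> s s0 _; apply: is_derive_fun_opp.
    have d := is_derive_fun_sub (is_derive_cst c s 1) (dV_ s s0).
    exact: (is_derive_fun_comp d (is_derive_sqr_pos_part (c - V s))).
  - move=> s s0 _; rewrite /dh sub0r mulrN opprK.
    case: (leP 0 (c - V s)) => h1; last by rewrite mulr0 mul0r.
    have [E|cV0] := eqVneq (c - V s) 0; first by rewrite E mulr0 mul0r.
    rewrite mulr_ge0_le0 ?mulr_ge0//; apply: neg => //.
    by rewrite -subr_gt0 lt_def cV0.
rewrite /h lerN2 (max_idPr _); last by rewrite subr_ge0 ltW.
have cV0 : 0 < c - V 0 by rewrite subr_gt0.
rewrite ler_pXn2r ?nnegrE ?le_max ?lexx ?(ltW cV0)//.
case/orP; first by move=> h1; lra.
by lra.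
Qed.

Lemma exponential_stability V dV (k t : R) : continuous V ->
  (forall s : R, 0 < s -> is_derive s 1 V (dV s)) ->
  (forall s : R, 0 < s -> dV s <= - k * V s) ->
  0 <= t -> V t <= V 0 * expR (- k * t).
Proof.
move=> cV dV_ ineq t0.
pose h (s : R) := V s * expR (k * s).
pose dh (s : R) := V s * (k * expR (k * s)) + expR (k * s) * dV s.
have : h t <= h 0.
  apply: (@le_of_derive_le0 R h dh 0 t t0).
  - apply: continuous_subspaceT => s; apply: cvgM; first exact: cV.
    exact: is_derive_continuous (is_derive_exp_scale k s).
  - move=> s s0 _; apply: is_derive_fun_mul; first exact: dV_.
    exact: is_derive_exp_scale.
  - move=> s s0 _.
    rewrite /dh [X in X <= 0](_ : _ = expR (k * s) * (dV s - - k * V s)).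
      by rewrite mulr_ge0_le0 ?expR_ge0// subr_le0 ineq.
    by ring.
rewrite /h mulr0 expR0 mulr1 => h1.
have -> : V t = V t * expR (k * t) * expR (- k * t).
  by rewrite -mulrA -expRD mulNr subrr expR0 mulr1.
by rewrite ler_wpM2r ?expR_ge0.
Qed.

End LyapunovFunctions.

(** * The Lyapunov function of the equilibrium seeking dynamics *)

Section SeekingErrors.
Context {R : realType} {N : nat}.
Variables (e : rel 'I_N) (K : 'I_N -> R) (thb : 'I_N -> 'I_N -> R).
Hypotheses (hK : forall i, 0 < K i) (hthb : forall i j, 0 < thb i j).
Notation adj := (@adjacency N R e).

Definition lyapunov (a : 'I_N -> R) (b : 'I_N -> 'I_N -> R) : R :=
  \sum_i (2 * K i)^-1 * a i ^+ 2 + \sum_i \sum_j (2 * thb i j)^-1 * b i j ^+ 2.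

Definition sqr_size (a : 'I_N -> R) (b : 'I_N -> 'I_N -> R) : R :=
  \sum_i a i ^+ 2 + \sum_i \sum_j b i j ^+ 2.

Lemma lyapunov_equivalent : exists2 c, 0 < c & exists2 C, 0 < C &
  forall a b, c * sqr_size a b <= lyapunov a b <= C * sqr_size a b.
Proof.
have k0 i : 0 < (2 * K i)^-1 by rewrite invr_gt0 mulr_gt0.
have t0 (p : 'I_N * 'I_N) : 0 < (2 * thb p.1 p.2)^-1 by rewrite invr_gt0 mulr_gt0.
have [c1 c10 hc1] := positive_lower_bound k0.
have [c2 c20 hc2] := positive_lower_bound t0.
pose C := 1 + \sum_i (2 * K i)^-1 + \sum_p (2 * thb p.1 p.2)^-1.
have s1 : 0 <= \sum_i (2 * K i)^-1 by apply: sumr_ge0 => i _; exact: ltW.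
have s2 : 0 <= \sum_p (2 * thb p.1 p.2)^-1 by apply: sumr_ge0 => i _; exact: ltW.
exists (Num.min c1 c2); first by rewrite lt_min c10.
exists C => [|a b]; first by rewrite /C; lra.
rewrite /sqr_size /lyapunov !mulrDr !mulr_sumr; apply/andP; split; apply: lerD;
  apply: ler_sum => i _; rewrite ?mulr_sumr.
- by rewrite ler_wpM2r ?sqr_ge0// ge_min hc1.
- apply: ler_sum => j _; rewrite ler_wpM2r ?sqr_ge0// ge_min.
  by rewrite (hc2 (i, j)) orbT.
- rewrite ler_wpM2r ?sqr_ge0// /C.
  have := ler_sum_term i (fun i => ltW (k0 i)); lra.
- apply: ler_sum => j _; rewrite ler_wpM2r ?sqr_ge0// /C.
  have := ler_sum_term (i, j) (fun i => ltW (t0 i)); rewrite /=; lra.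
Qed.

Lemma sqr_size_ge a b : (forall i, a i ^+ 2 <= sqr_size a b) /\
  (forall i j, b i j ^+ 2 <= sqr_size a b).
Proof.
have A0 : 0 <= \sum_i a i ^+ 2 by apply: sumr_ge0 => i _; exact: sqr_ge0.
have B0 i : 0 <= \sum_j b i j ^+ 2 by apply: sumr_ge0 => j _; exact: sqr_ge0.
split=> [i|i j]; rewrite /sqr_size.
  apply: (le_trans (ler_sum_term i (fun i => sqr_ge0 (a i)))).
  by rewrite lerDl sumr_ge0.
apply: (le_trans (ler_sum_term j (fun j => sqr_ge0 (b i j)))).
by apply: (le_trans (ler_sum_term i B0)); rewrite lerDr.
Qed.

Variables (th th1 : R) (xs : 'I_N -> R).
Variables (z g : 'I_N -> R -> R) (y : 'I_N -> 'I_N -> R -> R).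
Hypotheses (cz : forall i, continuous (z i)) (cy : forall i j, continuous (y i j)).
Hypothesis dz : forall i (t : R), 0 < t ->
  is_derive t 1 (z i) (- (th1 * K i) * g i t).
Hypothesis dy : forall i j (t : R), 0 < t ->
  is_derive t 1 (y i j) (- (th * th1 * thb i j) *
    (\sum_k adj i k * (y i j t - y k j t) + adj i j * (y i j t - z j t))).

Definition tracking_error (t : R) : 'I_N -> R := fun i => z i t - xs i.
Definition estimation_error (t : R) : 'I_N -> 'I_N -> R :=
  fun i j => y i j t - z j t.

Let V (t : R) := lyapunov (tracking_error t) (estimation_error t).

(** The weights of [lyapunov] cancel the gains [K i] and [thb i j], so that the
    monotonicity of the pseudo-gradient and the symmetry of the graph apply to
    what remains. *)
Lemma is_derive_lyapunov (t : R) : 0 < t ->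
  is_derive t 1 V (th1 * dissipation e K thb th
    (tracking_error t) (g ^~ t) (estimation_error t)).
Proof.
move=> t0.
have da i : is_derive t 1 (fun s => tracking_error s i) (- (th1 * K i) * g i t).
  by rewrite -[- _ * _]subr0; apply: is_derive_fun_sub; exact: dz.
have db i j := is_derive_fun_sub (dy i j t0) (dz j t0).
have := is_derive_fun_add
  (is_derive_fun_sum (fun i =>
     is_derive_fun_scale (2 * K i)^-1 (is_derive_fun_sqr (da i))))
  (is_derive_fun_sum (fun i => is_derive_fun_sum (fun j =>
     is_derive_fun_scale (2 * thb i j)^-1 (is_derive_fun_sqr (db i j))))).
rewrite [X in is_derive _ _ _ X](_ : _ = th1 * dissipation e K thb th
    (tracking_error t) (g ^~ t) (estimation_error t))//.
rewrite /dissipation !mulrDr -addrA; congr (_ + _).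
  rewrite mulrN mulr_sumr -sumrN; apply: eq_bigr => i _.
  by field; exact: lt0r_neq0.
rewrite mulrN mulrA !mulr_sumr -sumrN.
rewrite (eq_bigr _ (fun j _ => congr1 -%R (mulr_sumr _ _ _ _))).
under [X in _ = X + _]eq_bigr => j _ do rewrite -sumrN.
rewrite [X in _ = X + _]exchange_big/= -big_split/=; apply: eq_bigr => i _.
rewrite mulr_sumr -big_split/=; apply: eq_bigr => j _.
have -> : \sum_k adj i k * (y i j t - y k j t) + adj i j * (y i j t - z j t) =
  \sum_k adj i k * (estimation_error t i j - estimation_error t k j) +
   adj i j * estimation_error t i j.
  congr (_ + _); apply: eq_bigr => k _; congr (_ * _).
  by rewrite /estimation_error; ring.
rewrite -/(estimation_error t i j); field; exact: lt0r_neq0.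
Qed.

Lemma continuous_lyapunov : continuous V.
Proof.
move=> t; apply: cvgD; apply: continuous_fun_sum => i {}t.
  have c : {for t, continuous (fun s => tracking_error s i)}.
    by apply: cvgB; [exact: cz|exact: cvg_cst].
  by apply: cvgMr; apply: (@continuous_comp _ _ _ _ (fun r : R => r ^+ 2) t c);
    exact: exprn_continuous.
apply: continuous_fun_sum => j {}t.
have c : {for t, continuous (fun s => estimation_error s i j)}.
  by apply: cvgB; [exact: cy|exact: cz].
by apply: cvgMr; apply: (@continuous_comp _ _ _ _ (fun r : R => r ^+ 2) t c);
  exact: exprn_continuous.
Qed.

(** The dissipation inequality is only required while [V < c], that is where
    the gradients are under control; invariance of that sublevel set turns it
    into an inequality at all times. *)
Lemma lyapunov_decay (mu c C : R) : 0 < th1 -> 0 < mu -> 0 < C ->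
  (forall a b, lyapunov a b <= C * sqr_size a b) ->
  (forall t : R, 0 < t -> V t < c ->
     dissipation e K thb th (tracking_error t) (g ^~ t) (estimation_error t)
     <= - mu * sqr_size (tracking_error t) (estimation_error t)) ->
  V 0 < c -> forall t, 0 <= t ->
  V t <= V 0 /\ V t <= V 0 * expR (- (th1 * mu / C) * t).
Proof.
move=> th10 mu0 C0 VC diss V0c.
have size0 a b : 0 <= sqr_size a b.
  by apply: addr_ge0; apply: sumr_ge0 => i _; [|apply: sumr_ge0 => j _];
    exact: sqr_ge0.
have inv (t : R) : 0 <= t -> V t <= V 0.
  apply: (sublevel_invariant (c := c) continuous_lyapunov is_derive_lyapunov) => //.
  move=> s s0 Vs.
  rewrite pmulr_rle0//; apply: (le_trans (diss s s0 Vs)).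
  by rewrite mulNr oppr_le0 mulr_ge0// ltW.
move=> t t0; split; first exact: inv.
apply: (exponential_stability continuous_lyapunov is_derive_lyapunov) => // s s0.
apply: (@le_trans _ _
  (th1 * (- mu * sqr_size (tracking_error s) (estimation_error s)))).
  by rewrite ler_pM2l// diss// (le_lt_trans _ V0c)// inv// ltW.
rewrite !mulNr mulrN lerN2 [leLHS](_ : _ = th1 * mu * (V s / C)); last by ring.
rewrite [leRHS]mulrA ler_pM2l ?mulr_gt0// ler_pdivrMr// mulrC; exact: VC.
Qed.

End SeekingErrors.

(** * Convergence of the seeking dynamics *)

Section SeekingSystem.
Context {R : realType} {N : nat}.
Variables (f : 'I_N -> 'rV[R]_N -> R) (e : rel 'I_N) (m : R).
Variables (K : 'I_N -> R) (thb : 'I_N -> 'I_N -> R) (xstar : 'rV[R]_N).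
Hypotheses (hN : (2 <= N)%N) (hf : forall i, Ck 2 (f i)).
Hypotheses (e_sym : symmetric e) (hconn : connected_graph e).
Hypotheses (m0 : 0 < m) (hmono : strongly_monotone m (pseudo_gradient f)).
Hypotheses (hK : forall i, 0 < K i) (hthb : forall i j, 0 < thb i j).
Hypothesis hxstar : nash_equilibrium f xstar.

Notation G := (fun i => partial i (f i)).
Notation adj := (@adjacency N R e).

Lemma nash_critical i : partial i (f i) xstar = 0.
Proof.
by apply: partial_at_minimum; [have [_ /(_ i)[]] := hf i|exact: hxstar].
Qed.

Lemma enorm_sqr n (v : 'rV[R]_n) : enorm v ^+ 2 = \sum_i v 0 i ^+ 2.
Proof. by rewrite sqr_sqrtr// sumr_ge0// => i _; exact: sqr_ge0. Qed.

Lemma strongly_monotone_at_nash (u : 'rV[R]_N) :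
  m * \sum_i (u 0 i - xstar 0 i) ^+ 2 <=
    \sum_i (u 0 i - xstar 0 i) * partial i (f i) u.
Proof.
have := hmono u xstar; rewrite enorm_sqr !mxE.
under eq_bigr => i _ do rewrite !mxE.
under [leRHS]eq_bigr => i _ do rewrite !mxE nash_critical subr0.
by [].
Qed.

Lemma gradients_lipschitz_on_box r : exists2 L, 0 <= L &
  forall i u v, box xstar r u -> box xstar r v ->
    `|partial i (f i) u - partial i (f i) v| <= L * \sum_j `|u 0 j - v 0 j|.
Proof.
have /choice[L hL] i : exists L, 0 <= L /\
    forall u v, box xstar r u -> box xstar r v ->
    `|partial i (f i) u - partial i (f i) v| <= L * \sum_j `|u 0 j - v 0 j|.
  have [_ /(_ i)[_ /Ck1_lipschitz_on_box]] := hf i.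
  by move=> /(_ xstar r) [L L0 hL]; exists L.
have L0 i : 0 <= L i by have [] := hL i.
exists (\sum_i L i) => [|i u v bu bv]; first exact: sumr_ge0.
apply: (le_trans ((hL i).2 u v bu bv)); rewrite ler_wpM2r ?sumr_ge0//.
exact: ler_sum_term.
Qed.

Section ErrorEstimates.
Variables (L r q : R) (z : 'I_N -> R) (y : 'I_N -> 'I_N -> R).
Hypotheses (L0 : 0 <= L) (q0 : 0 <= q) (hr : r = 2 * (1 + q)).
Hypothesis hL : forall i u v, box xstar r u -> box xstar r v ->
  `|partial i (f i) u - partial i (f i) v| <= L * \sum_j `|u 0 j - v 0 j|.
Let a i := z i - xstar 0 i.
Let b i j := y i j - z j.
Hypothesis small : sqr_size a b <= q.

Let a_le i : `|a i| <= 1 + q.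
Proof.
have := le_trans ((sqr_size_ge a b).1 i) small.
by rewrite -[a i ^+ 2]real_normK ?num_real//; have := sqr_ge0 (`|a i| - 1); nra.
Qed.

Let b_le i j : `|b i j| <= 1 + q.
Proof.
have := le_trans ((sqr_size_ge a b).2 i j) small.
by rewrite -[b i j ^+ 2]real_normK ?num_real//; have := sqr_ge0 (`|b i j| - 1); nra.
Qed.

Let y_dist i j : `|y i j - xstar 0 j| <= `|b i j| + `|a j|.
Proof. by rewrite -(subrKA (z j)); exact: ler_normD. Qed.

Lemma estimates_in_box i : box xstar r (\row_j y i j).
Proof.
move=> j; rewrite mxE; apply: (le_trans (y_dist i j)).
by have := a_le j; have := b_le i j; rewrite hr; lra.
Qed.

Let center_in_box : box xstar r xstar.
Proof. by move=> j; rewrite subrr normr0 hr mulr_ge0// addr_ge0. Qed.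

Let z_in_box : box xstar r (\row_j z j).
Proof.
move=> j; rewrite mxE; apply: (le_trans (a_le j)); rewrite hr.
by have := q0; lra.
Qed.

Lemma gradient_at_estimate_le i :
  `|partial i (f i) (\row_j y i j)| <= L * \sum_j (`|b i j| + `|a j|).
Proof.
have := hL i (@estimates_in_box i) center_in_box; rewrite nash_critical subr0.
move=> /le_trans; apply; rewrite ler_wpM2l// ler_sum// => j _; rewrite mxE.
exact: y_dist.
Qed.

Lemma tracking_monotone :
  - \sum_i a i * partial i (f i) (\row_j y i j) <=
  - m * \sum_i a i ^+ 2 + \sum_i `|a i| * (L * \sum_j `|b i j|).
Proof.
have mono := strongly_monotone_at_nash (\row_j z j).
have -> : \sum_i a i * partial i (f i) (\row_j y i j) =
    \sum_i a i * partial i (f i) (\row_j z j) +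
    \sum_i a i * (partial i (f i) (\row_j y i j) - partial i (f i) (\row_j z j)).
  by rewrite -big_split; apply: eq_bigr => i _ /=; ring.
rewrite opprD mulNr lerD//.
  rewrite lerN2; move: mono; congr (m * _ <= _);
    by apply: eq_bigr => i _; rewrite mxE.
rewrite -sumrN ler_sum// => i _; apply: (le_trans (ler_norm _)).
rewrite normrN normrM ler_wpM2l//.
apply: (le_trans (hL i (@estimates_in_box i) z_in_box)).
by rewrite ler_wpM2l// ler_sum// => j _; rewrite !mxE.
Qed.

End ErrorEstimates.

(** The gradients [H] are only assumed to agree with those of the costs on a
    box around the equilibrium, since the errors never leave it: the same
    statement serves for the original system and for the globally Lipschitz
    one from which solutions are obtained. *)
Lemma seeking_system_stable (Delta : R) : exists2 r, 0 <= r &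
  exists2 th0, 0 < th0 & forall th th1, th0 <= th -> 0 < th1 ->
  forall (H : 'I_N -> 'rV[R]_N -> R) (z : 'I_N -> R -> R)
         (y : 'I_N -> 'I_N -> R -> R),
  (forall i v, box xstar r v -> H i v = partial i (f i) v) ->
  (forall i, continuous (z i)) -> (forall i j, continuous (y i j)) ->
  (forall i (t : R), 0 < t ->
    is_derive t 1 (z i) (- (th1 * K i) * H i (\row_j y i j t))) ->
  (forall i j (t : R), 0 < t ->
    is_derive t 1 (y i j) (- (th * th1 * thb i j) *
      (\sum_k adj i k * (y i j t - y k j t) + adj i j * (y i j t - z j t)))) ->
  sqr_size (fun i => z i 0 - xstar 0 i) (fun i j => y i j 0 - z j 0)
    <= Delta ^+ 2 ->
  (forall i (t : R), 0 <= t -> box xstar r (\row_j y i j t)) /\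
  exists C k, [/\ 0 <= C, 0 < k & forall i (t : R), 0 <= t ->
    `|z i t - xstar 0 i| <= C * expR (- k * t) /\
    `|H i (\row_j y i j t)| <= C * expR (- k * t)].
Proof.
have [c c0 [C C0 equiv]] := lyapunov_equivalent hK hthb.
have [l l0 coercive] := @grounded_form_coercive R N e e_sym hN hconn.
(* [C * Delta ^+ 2] bounds the Lyapunov function at time 0, [c1] is a strictly
   larger level, [q] the size of the errors at that level. The factor 2 in [r]
   accounts for [y i j - xstar 0 j = b i j + a j]. *)
pose c1 := C * Delta ^+ 2 + 1; pose q := c1 / c; pose r := 2 * (1 + q).
have c10 : 0 < c1 by rewrite ltr_wpDl// mulr_ge0 ?sqr_ge0// ltW.
have q0 : 0 <= q by rewrite divr_ge0// ltW.
have [L L0 hL] := gradients_lipschitz_on_box r.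
have [th0 th00 diss] := @dissipation_le R N e m l L K thb (ltnW hN) m0 l0 L0
  hK hthb coercive.
exists r; first by rewrite mulr_ge0// addr_ge0.
exists th0 => // th th1 th_ge th10 H z y HG cz cy dz dy init.
pose a t := tracking_error (xstar 0) z t; pose b t := estimation_error z y t.
have small (t : R) : lyapunov K thb (a t) (b t) < c1 -> sqr_size (a t) (b t) <= q.
  have /andP[h1 _] := equiv (a t) (b t).
  by move=> /ltW /(le_trans h1); rewrite mulrC -ler_pdivlMr.
have in_box (t : R) : sqr_size (a t) (b t) <= q ->
    forall i, box xstar r (\row_j y i j t).
  exact: (estimates_in_box (z := z ^~ t) (y := fun i j => y i j t) (erefl r)).
have g_le (t : R) : sqr_size (a t) (b t) <= q -> forall i,
    `|partial i (f i) (\row_j y i j t)| <= L * \sum_j (`|b t i j| + `|a t j|).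
  exact: (gradient_at_estimate_le (z := z ^~ t) (y := fun i j => y i j t)
    L0 q0 (erefl r) hL).
have start : lyapunov K thb (a 0) (b 0) < c1.
  have /andP[_ h2] := equiv (a 0) (b 0).
  apply: (le_lt_trans h2); rewrite /c1 ltr_pwDr// ler_pM2l//.
have m20 : 0 < m / 2 by rewrite divr_gt0.
have decay := lyapunov_decay (g := fun i t => H i (\row_j y i j t))
  hK hthb cz cy dz dy th10 m20 C0 (fun a b => (andP (equiv a b)).2) _ start.
have {}decay (t : R) : 0 <= t ->
    lyapunov K thb (a t) (b t) <= lyapunov K thb (a 0) (b 0) /\
    lyapunov K thb (a t) (b t) <= lyapunov K thb (a 0) (b 0) *
      expR (- (th1 * (m / 2) / C) * t).
  apply: decay => s s0 /small sq.
  have gE : (fun i => H i (\row_j y i j s)) =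
      fun i => partial i (f i) (\row_j y i j s).
    by apply/funext => i; apply: HG; exact: in_box.
  rewrite /= gE; apply: diss => //.
    exact: (tracking_monotone (z := z ^~ s) (y := fun i j => y i j s)
      L0 q0 (erefl r) hL sq).
  exact: g_le.
have inside (t : R) : 0 <= t -> sqr_size (a t) (b t) <= q.
  by move=> /decay[h _]; apply: small; exact: le_lt_trans start.
split=> [i t /inside h|]; first exact: in_box.
(* The errors are square roots of the Lyapunov function, whence [k / 2]. *)
pose k := th1 * (m / 2) / C; pose v0 := lyapunov K thb (a 0) (b 0) / c.
have k0 : 0 < k by rewrite divr_gt0// mulr_gt0.
have v00 : 0 <= v0.
  rewrite divr_ge0 ?(ltW c0)// (le_trans _ (andP (equiv (a 0) (b 0))).1)//.
  rewrite mulr_ge0 ?(ltW c0)// addr_ge0// sumr_ge0// => i _; first exact: sqr_ge0.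
  by apply: sumr_ge0 => j _; exact: sqr_ge0.
pose M := 1 + v0; pose E (t : R) := expR (- (k / 2) * t).
have EE t : expR (- k * t) = E t ^+ 2.
  by rewrite /E expr2 -expRD; congr expR; field.
have E0 t : 0 < E t by exact: expR_gt0.
have M1 : 1 <= M by rewrite lerDl.
have of_sqr (w t : R) : 0 <= t -> w ^+ 2 <= sqr_size (a t) (b t) -> `|w| <= M * E t.
  move=> t0 hw; have [_ h] := decay t t0.
  rewrite -(@ler_pXn2r _ 2)// ?nnegrE ?mulr_ge0 ?(ltW (E0 t))//; last lra.
  rewrite real_normK ?num_real// exprMn -EE; apply: (le_trans hw).
  have /andP[h1 _] := equiv (a t) (b t).
  apply: (@le_trans _ _ (v0 * expR (- k * t))).
    rewrite -(ler_pM2l c0); apply: (le_trans h1); apply: (le_trans h).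
    by rewrite /v0 [leRHS]mulrA [c * _]mulrC divfK// gt_eqF.
  by rewrite ler_wpM2r ?expR_ge0// /M; have := sqr_ge0 v0; nra.
have a_le i (t : R) : 0 <= t -> `|z i t - xstar 0 i| <= M * E t.
  by move=> t0; apply: of_sqr => //; exact: (sqr_size_ge (a t) (b t)).1.
have b_le i j (t : R) : 0 <= t -> `|y i j t - z j t| <= M * E t.
  by move=> t0; apply: of_sqr => //; exact: (sqr_size_ge (a t) (b t)).2.
have n0 : 0 <= N%:R :> R by exact: ler0n.
exists (M + L * (N%:R * (2 * M))), (k / 2); split.
- by rewrite addr_ge0 ?mulr_ge0//; lra.
- by rewrite divr_gt0.
move=> i t t0; rewrite mulrDl -/(E t); split.
  apply: (le_trans (a_le i t t0)); rewrite lerDl !mulr_ge0 ?(ltW (E0 t))//; lra.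
rewrite (HG i _ (in_box t (inside t t0) i)).
apply: (le_trans (g_le t (inside t t0) i)).
apply: (@le_trans _ _ (L * \sum_(j < N) (M * E t + M * E t))).
  by rewrite ler_wpM2l// ler_sum// => j _; rewrite lerD ?a_le ?b_le.
rewrite sumr_const card_ord -[in leLHS]mulr_natl.
have ME : 0 <= M * E t by rewrite mulr_ge0 ?(ltW (E0 t))//; lra.
by lra.
Qed.

End SeekingSystem.

(** * Lipschitz vector fields *)

Section SumLipschitzRules.
Context {R : realType} {I : finType}.
Implicit Types (phi psi : (I -> R) -> R).

Lemma sum_lipschitz_proj k : sum_lipschitz (fun u : I -> R => u k).
Proof.
exists 1 => // u v; rewrite mul1r.
exact: (ler_sum_term k (fun j => normr_ge0 (u j - v j))).
Qed.

Lemma sum_lipschitz_add phi psi : sum_lipschitz phi -> sum_lipschitz psi ->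
  sum_lipschitz (fun u => phi u + psi u).
Proof.
move=> [L L0 hL] [M M0 hM]; exists (L + M) => [|u v]; first exact: addr_ge0.
rewrite opprD addrACA mulrDl; apply: (le_trans (ler_normD _ _)).
by rewrite lerD.
Qed.

Lemma sum_lipschitz_scale c phi : sum_lipschitz phi ->
  sum_lipschitz (fun u => c * phi u).
Proof.
move=> [L L0 hL]; exists (`|c| * L) => [|u v]; first exact: mulr_ge0.
by rewrite -mulrBr normrM -mulrA ler_wpM2l.
Qed.

Lemma sum_lipschitz_opp phi : sum_lipschitz phi ->
  sum_lipschitz (fun u => - phi u).
Proof.
move=> [L L0 hL]; exists L => // u v.
by rewrite -opprD normrN.
Qed.

Lemma sum_lipschitz_sub phi psi : sum_lipschitz phi -> sum_lipschitz psi ->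
  sum_lipschitz (fun u => phi u - psi u).
Proof. by move=> hphi /sum_lipschitz_opp; exact: sum_lipschitz_add. Qed.

Lemma sum_lipschitz_sum (J : finType) (F : J -> (I -> R) -> R) :
  (forall j, sum_lipschitz (F j)) -> sum_lipschitz (fun u => \sum_j F j u).
Proof.
move=> hF; elim: (index_enum J) => [|j r ih].
  by exists 0 => // u v; rewrite !big_nil subrr normr0 mul0r.
have [L L0 hL] := sum_lipschitz_add (hF j) ih.
by exists L => // u v; rewrite !big_cons.
Qed.

Lemma sum_lipschitz_comp (h : R -> R) phi :
  (forall a b, `|h a - h b| <= `|a - b|) -> sum_lipschitz phi ->
  sum_lipschitz (fun u => h (phi u)).
Proof.
by move=> hh [L L0 hL]; exists L => // u v; apply: (le_trans (hh _ _)).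
Qed.

Lemma sum_lipschitz_row_clip N (g : 'rV[R]_N -> R) c r L (k : 'I_N -> I) :
  0 <= r -> 0 <= L ->
  (forall u v, box c r u -> box c r v ->
     `|g u - g v| <= L * \sum_j `|u 0 j - v 0 j|) ->
  sum_lipschitz (fun u => g (clip c r (\row_j u (k j)))).
Proof.
move=> r0 L0 hL; exists (L * N%:R) => [|u v]; first by rewrite mulr_ge0.
apply: (le_trans (hL _ _ (clip_in_box _ _ r0) (clip_in_box _ _ r0))).
rewrite -mulrA ler_wpM2l//.
apply: (@le_trans _ _ (\sum_(j < N) \sum_i `|u i - v i|)).
  apply: ler_sum => j _; apply: (le_trans (clip_nonexpansive _ _ _ _ _)).
  by rewrite !mxE; exact: (ler_sum_term (k j) (fun i => normr_ge0 (u i - v i))).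
by rewrite sumr_const card_ord mulr_natl.
Qed.

Lemma picard_lindelof_componentwise (F : (I -> R) -> I -> R) (u0 : I -> R) :
  (forall i, sum_lipschitz (F ^~ i)) ->
  exists u : I -> R -> R, [/\ forall i, continuous (u i), forall i, u i 0 = u0 i &
    forall i (t : R), 0 < t -> is_derive t 1 (u i) (F (u ^~ t) i)].
Proof.
move=> lipF.
have /choice[L hL] i : exists L, 0 <= L /\
    forall u v, `|F u i - F v i| <= L * \sum_j `|u j - v j|.
  by have [L L0 hL] := lipF i; exists L.
have L0 i : 0 <= L i by have [] := hL i.
apply: (@picard_lindelof _ _ _ _ (\sum_i L i)) => [|i u v]; first exact: sumr_ge0.
apply: (le_trans ((hL i).2 u v)); rewrite ler_wpM2r ?sumr_ge0//.
exact: ler_sum_term.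
Qed.

End SumLipschitzRules.

(** * The closed loop *)

Section ClosedLoop.
Context {R : realType} {N : nat}.
Variables (e : rel 'I_N) (U : R) (Kb : 'I_N -> R) (thm : 'I_N -> 'I_N -> R).
Hypothesis U0 : 0 < U.
Notation adj := (@adjacency N R e).

(** Continuity is asked on the whole line, which trajectories satisfy once they
    are frozen for negative times. The gradients are arbitrary functions [H]
    because the system with clipped gradients is an instance too. *)
Record coordinate_solution (H : 'I_N -> 'rV[R]_N -> R)
    (x nu z : 'I_N -> R -> R) (y : 'I_N -> 'I_N -> R -> R) : Prop := {
  csol_x_cont : forall i, continuous (x i);
  csol_nu_cont : forall i, continuous (nu i);
  csol_z_cont : forall i, continuous (z i);
  csol_y_cont : forall i j, continuous (y i j);
  csol_x : forall i (t : R), 0 < t -> is_derive t 1 (x i) (nu i t);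
  csol_nu : forall i (t : R), 0 < t -> is_derive t 1 (nu i)
    (- saturation U ((x i t - z i t) +
       (nu i t - - Kb i * H i (\row_j y i j t))));
  csol_z : forall i (t : R), 0 < t ->
    is_derive t 1 (z i) (- Kb i * H i (\row_j y i j t));
  csol_y : forall i j (t : R), 0 < t -> is_derive t 1 (y i j)
    (- thm i j * (\sum_k adj i k * (y i j t - y k j t)
       + adj i j * (y i j t - z j t)))
}.

Lemma coordinate_solution_exists (H : 'I_N -> 'rV[R]_N -> R) c r L
    (x0 nu0 z0 : 'rV[R]_N) (y0 : 'M[R]_N) :
  0 <= r -> 0 <= L ->
  (forall i u v, box c r u -> box c r v ->
     `|H i u - H i v| <= L * \sum_j `|u 0 j - v 0 j|) ->
  exists x nu z y, coordinate_solution (fun i v => H i (clip c r v)) x nu z y /\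
    [/\ forall i, x i 0 = x0 0 i, forall i, nu i 0 = nu0 0 i,
        forall i, z i 0 = z0 0 i & forall i j, y i j 0 = y0 i j].
Proof.
move=> r0 L0 hL.
pose I : finType := ('I_N + 'I_N + ('I_N + 'I_N * 'I_N))%type.
pose kx i : I := inl (inl i); pose kn i : I := inl (inr i).
pose kz i : I := inr (inl i); pose ky i j : I := inr (inr (i, j)).
pose Hc (u : I -> R) i := H i (clip c r (\row_j u (ky i j))).
pose F (u : I -> R) (k : I) : R := match k with
  | inl (inl i) => u (kn i)
  | inl (inr i) => - saturation U ((u (kx i) - u (kz i)) +
                      (u (kn i) - - Kb i * Hc u i))
  | inr (inl i) => - Kb i * Hc u i
  | inr (inr (i, j)) => - thm i j * (\sum_k adj i k * (u (ky i j) - u (ky k j))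
                      + adj i j * (u (ky i j) - u (kz j)))
  end.
pose u0 (k : I) : R := match k with
  | inl (inl i) => x0 0 i
  | inl (inr i) => nu0 0 i
  | inr (inl i) => z0 0 i
  | inr (inr (i, j)) => y0 i j
  end.
have lipH i : sum_lipschitz (fun u => - Kb i * Hc u i).
  apply: sum_lipschitz_scale; exact: (sum_lipschitz_row_clip (ky i) r0 L0 (hL i)).
have lipB k k' : sum_lipschitz (fun u : I -> R => u k - u k').
  by apply: sum_lipschitz_sub; exact: sum_lipschitz_proj.
have lipF k : sum_lipschitz (F ^~ k).
  case: k => [[i|i]|[i|[i j]]] /=; last 1 first.
  - apply: sum_lipschitz_scale; apply: sum_lipschitz_add.
      by apply: sum_lipschitz_sum => k; exact: sum_lipschitz_scale.
    exact: sum_lipschitz_scale.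
  - exact: sum_lipschitz_proj.
  - apply: sum_lipschitz_opp; apply: sum_lipschitz_comp.
      exact: saturation_lipschitz.
    by apply: sum_lipschitz_add => //; apply: sum_lipschitz_sub => //;
      exact: sum_lipschitz_proj.
  - exact: lipH.
have [u [cu hu0 du]] := picard_lindelof_componentwise u0 lipF.
exists (fun i => u (kx i)), (fun i => u (kn i)), (fun i => u (kz i)),
  (fun i j => u (ky i j)); split; last first.
  by split=> [i|i|i|i j]; rewrite hu0.
split=> [i|i|i|i j|i t t0|i t t0|i t t0|i j t t0]; try exact: cu.
- exact: (du (kx i) t t0).
- exact: (du (kn i) t t0).
- exact: (du (kz i) t t0).
- exact: (du (ky i j) t t0).
Qed.

(** Once [z] and its velocity have converged, the position and velocity of each
    player form a perturbed saturated double integrator, the perturbation being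
    [d] below. *)
Lemma coordinate_solution_cvg H x nu z y (xs : 'I_N -> R) (C k : R) :
  coordinate_solution H x nu z y -> 0 <= C -> 0 < k ->
  (forall i (t : R), 0 <= t -> `|z i t - xs i| <= C * expR (- k * t) /\
     `|H i (\row_j y i j t)| <= C * expR (- k * t)) ->
  forall i, x i t @[t --> +oo] --> xs i.
Proof.
move=> sol C0 k0 decay i.
pose d (t : R) := - (z i t - xs i) + Kb i * H i (\row_j y i j t).
suff cv : x i t - xs i @[t --> +oo] --> (0 : R).
  have h : x i t - xs i + xs i @[t --> +oo] --> 0 + xs i.
    by apply: cvgD => //; exact: cvg_cst.
  rewrite add0r in h; apply: cvg_trans h; apply: near_eq_cvg.
  by near=> t; rewrite subrK.
apply: (@saturated_double_integrator_cvg0 R U ((1 + `|Kb i|) * C) k _ (nu i) d) => //.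
- by rewrite mulr_ge0// addr_ge0.
- move=> t t0; have := is_derive_fun_sub (csol_x sol i t0) (is_derive_cst (xs i) t 1).
  by rewrite subr0.
- move=> t t0; have := csol_nu sol i t0.
  rewrite [X in is_derive _ _ _ (- saturation U X) -> _](_ : _ =
    x i t - xs i + nu i t + d t)//.
  by rewrite /d; ring.
- move=> t t0; have [h1 h2] := decay i t (ltW t0).
  apply: (le_trans (ler_normD _ _)); rewrite normrN normrM -mulrA mulrDl mul1r.
  by rewrite lerD// ler_wpM2l.
Unshelve. all: by end_near. Qed.

Lemma forward_solution_coordinates f x nu z y :
  forward_solution f e U Kb thm x nu z y ->
  coordinate_solution (fun i => partial i (f i))
    (fun i t => x (Num.max 0 t) 0 i) (fun i t => nu (Num.max 0 t) 0 i)
    (fun i t => z (Num.max 0 t) 0 i) (fun i j t => y (Num.max 0 t) i j).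
Proof.
move=> [cx cn cz cy dx dn dz dy].
have entry m n (M : R -> 'M[R]_(m, n)) i j : {within `[0, +oo[, continuous M} ->
    continuous (fun t : R => M (Num.max 0 t) i j).
  move=> /continuous_of_within_ge0 cM t.
  apply: (@continuous_comp _ _ _ (fun t : R => M (Num.max 0 t))
    (fun A : 'M[R]_(m, n) => A i j)); first exact: cM.
  exact: coord_continuous.
have rowE i t : \row_j y t i j = row i (y t) by apply/rowP => j; rewrite !mxE.
split=> [i|i|i|i j|i t t0|i t t0|i t t0|i j t t0]; try exact: entry.
- rewrite (max_idPr (ltW t0)); apply/(is_derive_max0 (fun s : R => x s 0 i)) => //.
  exact: (is_derive_mxP _ _ _).1 (dx t t0) 0 i.
- rewrite (max_idPr (ltW t0)); apply/(is_derive_max0 (fun s : R => nu s 0 i)) => //.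
  by have := (is_derive_mxP _ _ _).1 (dn t t0) 0 i; rewrite rowE !mxE.
- rewrite (max_idPr (ltW t0)); apply/(is_derive_max0 (fun s : R => z s 0 i)) => //.
  by have := (is_derive_mxP _ _ _).1 (dz t t0) 0 i; rewrite rowE !mxE.
- rewrite (max_idPr (ltW t0)); apply/(is_derive_max0 (fun s : R => y s i j)) => //.
  by have := (is_derive_mxP _ _ _).1 (dy t t0) i j; rewrite !mxE.
Qed.

Lemma forward_solution_of_coordinates f (H : 'I_N -> 'rV[R]_N -> R) x nu z y :
  coordinate_solution H x nu z y ->
  (forall i (t : R), 0 <= t ->
     H i (\row_j y i j t) = partial i (f i) (\row_j y i j t)) ->
  forward_solution f e U Kb thm (fun t => \row_i x i t) (fun t => \row_i nu i t)
    (fun t => \row_i z i t) (fun t => \matrix_(i, j) y i j t).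
Proof.
move=> [cx cn cz cy dx dn dz dy] HE.
have matrix_cont m n (M : 'I_m -> 'I_n -> R -> R) : (forall i j, continuous (M i j)) ->
    {within `[0, +oo[, continuous (fun t => \matrix_(i, j) M i j t)}.
  move=> cM; apply: continuous_subspaceT => t.
  apply: (@cvg_mx R R (nbhs t)) => i j.
  by rewrite mxE; under eq_fun do rewrite mxE; exact: cM.
have entryE (h : R -> R) m n (M : 'I_m -> 'I_n -> R -> R) i j :
    (fun s => (\matrix_(i, j) M i j s) i j) = M i j.
  by apply/funext => s; rewrite mxE.
have rowE i t : row i (\matrix_(i, j) y i j t) = \row_j y i j t.
  by apply/rowP => j; rewrite !mxE.
split=> [||||t t0|t t0|t t0|t t0]; try exact: matrix_cont.
- apply/is_derive_mxP => i j; rewrite entryE// mxE; exact: dx.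
- apply/is_derive_mxP => i j; rewrite entryE// !mxE rowE -HE ?(ltW t0)//; exact: dn.
- apply/is_derive_mxP => i j; rewrite entryE// !mxE rowE -HE ?(ltW t0)//; exact: dz.
- apply/is_derive_mxP => i j; rewrite entryE// !mxE.
  have -> : \sum_k adj i k * (y i j t - (\matrix_(i, j) y i j t) k j)
    = \sum_k adj i k * (y i j t - y k j t).
    by apply: eq_bigr => k _; rewrite !mxE.
  exact: dy.
Qed.

End ClosedLoop.

(** * Initial errors *)

Section InitialError.
Context {R : realType}.

Lemma sum_sqr_row_mx m n (A : 'rV[R]_m) (B : 'rV[R]_n) :
  \sum_i row_mx A B 0 i ^+ 2 = \sum_i A 0 i ^+ 2 + \sum_i B 0 i ^+ 2.
Proof.
by rewrite big_split_ord/=; congr (_ + _); apply: eq_bigr => i _;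
  rewrite ?row_mxEl ?row_mxEr.
Qed.

Lemma sum_sqr_mxvec m n (A : 'M[R]_(m, n)) :
  \sum_i mxvec A 0 i ^+ 2 = \sum_i \sum_j A i j ^+ 2.
Proof.
rewrite pair_bigA/= (reindex _ (curry_mxvec_bij m n))/=.
by apply: eq_bigr => -[i j] _; rewrite /= mxvecE.
Qed.

Lemma sqr_size_le_initial_error N (f : 'I_N -> 'rV[R]_N -> R) Kb xstar
    (x0 nu0 z0 : 'rV[R]_N) (y0 : 'M[R]_N) Delta :
  initial_error f Kb xstar x0 nu0 z0 y0 <= Delta ->
  sqr_size (fun i => z0 0 i - xstar 0 i) (fun i j => y0 i j - z0 0 j)
    <= Delta ^+ 2.
Proof.
move=> h; have s0 n (v : 'rV[R]_n) : 0 <= \sum_i v 0 i ^+ 2.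
  by apply: sumr_ge0 => i _; exact: sqr_ge0.
have ie0 : 0 <= initial_error f Kb xstar x0 nu0 z0 y0 by exact: sqrtr_ge0.
apply: (@le_trans _ _ (initial_error f Kb xstar x0 nu0 z0 y0 ^+ 2)); last first.
  by rewrite ler_pXn2r ?nnegrE// (le_trans ie0).
rewrite /initial_error enorm_sqr !sum_sqr_row_mx sum_sqr_mxvec /sqr_size.
have -> : \sum_i \sum_j (y0 - (const_mx 1 : 'cV[R]_N) *m z0) i j ^+ 2 =
    \sum_i \sum_j (y0 i j - z0 0 j) ^+ 2.
  apply: eq_bigr => i _; apply: eq_bigr => j _.
  by rewrite !mxE big_ord1 !mxE mul1r.
have -> : \sum_i (z0 - xstar) 0 i ^+ 2 = \sum_i (z0 0 i - xstar 0 i) ^+ 2.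
  by apply: eq_bigr => i _; rewrite !mxE.
have := s0 _ (nu0 - zdot f Kb y0); have := s0 _ (x0 - z0); lra.
Qed.

End InitialError.

(** * Convergence to the Nash equilibrium *)

Unset Implicit Arguments.

Theorem theorem5 (R : realType) (N : nat) (hN : (2 <= N)%N)
    (f : 'I_N -> 'rV[R]_N -> R) (hf : forall i : 'I_N, Ck 2 (f i))
    (e : rel 'I_N) (he : undirected_graph e) (hconn : connected_graph e)
    (hmono : exists2 m : R, 0 < m & strongly_monotone m (pseudo_gradient f))
    (U : R) (hU : 0 < U)
    (K : 'I_N -> R) (hK : forall i : 'I_N, 0 < K i)
    (thb : 'I_N -> 'I_N -> R) (hthb : forall i j : 'I_N, 0 < thb i j)
    (xstar : 'rV[R]_N) (hxstar : nash_equilibrium f xstar) :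
  forall Delta : R, 0 < Delta ->
  exists2 thstar : R, 0 < thstar &
  forall th : R, thstar < th ->
  exists2 th1star : R, 0 < th1star &
  forall th1 : R, 0 < th1 -> th1 < th1star ->
  let Kb := fun i : 'I_N => th1 * K i in
  let thm := fun i j : 'I_N => th * th1 * thb i j in
  forall (x0 nu0 z0 : 'rV[R]_N) (y0 : 'M[R]_N),
  initial_error f Kb xstar x0 nu0 z0 y0 <= Delta ->
  (exists (x nu z : R -> 'rV[R]_N) (y : R -> 'M[R]_N),
     forward_solution f e U Kb thm x nu z y /\
     [/\ x 0 = x0, nu 0 = nu0, z 0 = z0 & y 0 = y0]) /\
  (forall (x nu z : R -> 'rV[R]_N) (y : R -> 'M[R]_N),
     forward_solution f e U Kb thm x nu z y ->
     [/\ x 0 = x0, nu 0 = nu0, z 0 = z0 & y 0 = y0] ->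
     x t @[t --> +oo] --> xstar).
Proof.
move=> Delta _; have [m m0 mono] := hmono.
have [r r0 [th0 th00 stable]] := seeking_system_stable hN hf he.1 hconn m0 mono
  hK hthb hxstar Delta.
have [L L0 hL] := gradients_lipschitz_on_box xstar hf r.
(* The witness 1 is arbitrary: [th1] only rescales the time of (z, y). *)
exists th0 => // th /ltW th_ge; exists 1 => // th1 th10 _ Kb thm x0 nu0 z0 y0 init.
have start := sqr_size_le_initial_error init.
split.
  have [x [nu [z [y [sol [hx hnu hz hy]]]]]] := coordinate_solution_exists
    e Kb thm hU x0 nu0 z0 y0 r0 L0 hL.
  have [|inside _] := stable th th1 th_ge th10 _ z y
    (fun i v bv => congr1 _ (clip_id bv)) (csol_z_cont sol) (csol_y_cont sol)
    (csol_z sol) (csol_y sol).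
    apply: le_trans start; rewrite le_eqVlt; apply/orP; left; apply/eqP.
    by congr sqr_size; apply/funext => i; [|apply/funext => j]; rewrite ?hy hz.
  exists (fun t => \row_i x i t), (fun t => \row_i nu i t),
    (fun t => \row_i z i t), (fun t => \matrix_(i, j) y i j t); split.
    apply: (forward_solution_of_coordinates sol) => i t t0.
    by rewrite clip_id//; exact: inside.
  by split; [apply/rowP => i|apply/rowP => i|apply/rowP => i|apply/matrixP => i j];
    rewrite mxE.
move=> x nu z y fsol [hx hnu hz hy].
have sol := forward_solution_coordinates fsol.
have [|_ [C [k [C0 k0 decay]]]] := stable th th1 th_ge th10 _ _ _
    (fun i v bv => erefl) (csol_z_cont sol) (csol_y_cont sol)
    (csol_z sol) (csol_y sol).
  by rewrite maxxx hz hy.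
have cv := coordinate_solution_cvg hU sol C0 k0 decay.
apply: cvg_mx => i j; rewrite (ord1 i).
apply: cvg_trans (cv j); apply: near_eq_cvg.
near=> t; congr (x _ _ _); apply/max_idPr; near: t; exact: nbhs_pinfty_ge.
Unshelve. all: by end_near. Qed.
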